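(* Let $q$ be a prime power and let $m$ be an even positive integer. Then $\mathcal{D}_{(q,m)}$ is a cyclic code over $\mathbb{F}_q$ with parameters $[q^{2m}-1,\; m^2+2m,\; q^{2m-2}(q^2-q-1)]$, and its weight distribution is given by the following list of (Hamming weight, frequency) pairs, where $f_j$ is as defined in the context: \begin{itemize} \item weight $0$, frequency $1$; \item weight $q^{2m}-q^{2m-1}$, frequency $q^{2m}-1+\sum_{j=1}^{m}(q^{2m}-q^{2j})f_j$; \item for each $1\le j\le m$: weight $q^{2m}-q^{2m-1}-(-1)^jq^{2m-j-1}(q-1)$, frequency $\bigl(q^{2j-1}+(-1)^jq^{j-1}(q-1)\bigr)f_j$; \item for each $1\le j\le m$: weight $q^{2m}-q^{2m-1}+(-1)^jq^{2m-j-1}$, frequency $\bigl(q^{2j-1}-(-1)^jq^{j-1}\bigr)(q-1)f_j$. \end{itemize}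
   Context: An $[n,k,d]$ code over $\mathbb{F}_q$ is a $k$-dimensional subspace of $\mathbb{F}_q^n$ with minimum Hamming distance $d$. Vectors $(c_0,\dots,c_{n-1})\in\mathbb{F}_q^n$ are identified with $c_0+c_1x+\cdots+c_{n-1}x^{n-1}\in\mathbb{F}_q[x]/(x^n-1)$; a cyclic code is an ideal $\langle g(x)\rangle$ with $g$ monic dividing $x^n-1$, and $(x^n-1)/g(x)$ is its parity-check polynomial. The weight distribution records the number $A_w$ of codewords of each Hamming weight $w$; $A_w$ is the sum of the frequencies of all listed entries whose weight equals $w$ (and $0$ if there are none). Definition of $\mathcal{D}_{(q,m)}$ for even $m$: let $s=2m$, $n=q^s-1$, $t=m/2$, let $\pi$ be a generator of $\mathbb{F}_{q^s}^*$, and for an integer $u$ let $h_u(x)$ be the minimal polynomial of $\pi^{-u}$ over $\mathbb{F}_q$. Let $\Gamma=\{1\}\cup\{q^{2i-1}+1:1\le i\le t\}$ and $h(x)=\prod_{u\in\Gamma}h_u(x)$. Then $\mathcal{D}_{(q,m)}$ is the cyclic code of length $n$ over $\mathbb{F}_q$ with parity-check polynomial $h(x)$. The numbers $f_j$: $f_0=1$ and, for $1\le j\le m$, $$f_j=\left(\prod_{i=0}^{j-1}\frac{(-q)^m-(-q)^i}{(-q)^j-(-q)^i}\right)\prod_{\ell=0}^{j-1}\left((-1)^{m+1}q^m+(-1)^{\ell+1}q^{\ell}\right).$$ *)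

(* Defs.v *)
From HB Require Import structures.
From mathcomp Require Import all_boot all_order all_algebra all_field.

Set Implicit Arguments.
Unset Strict Implicit.
Unset Printing Implicit Defensive.

Import Order.TTheory GRing.Theory Num.Theory.
Local Open Scope ring_scope.

Section Codes.

Variables (F : finFieldType) (n : nat).
Implicit Types (c x y : 'rV[F]_n) (C : {set 'rV[F]_n}).

Definition hamming_weight c : nat := #|[set i | c 0 i != 0]|.

Definition hamming_dist x y : nat := #|[set i | x 0 i != y 0 i]|.

Definition min_distance_is C (d : nat) : Prop :=
  (exists x y, [/\ x \in C, y \in C, x != y & hamming_dist x y = d])
  /\ (forall x y, x \in C -> y \in C -> x != y -> (d <= hamming_dist x y)%N).

(* The length of the [n, k, d] code is carried by the type of C. *)
Definition linear_code_params C (k d : nat) : Prop :=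
  (exists V : {vspace 'rV[F]_n}, C =i V /\ \dim V = k) /\ min_distance_is C d.

Definition weight_count C (w : nat) : nat :=
  #|[set c in C | hamming_weight c == w]|.

(* The ideal generated by g in F[x]/(x^n - 1), with residue classes given by
   their representatives of degree < n; rVpoly c is \sum_i c_i x^i. *)
Definition cyclic_ideal (g : {poly F}) : {set 'rV[F]_n} :=
  [set c | [exists a : 'rV[F]_n,
             rVpoly c == (rVpoly a * g) %% ('X^n - 1)]].

Definition cyclic_code_with_parity_check C (h : {poly F}) : Prop :=
  exists g : {poly F},
    [/\ g \is monic, g %| 'X^n - 1, C = cyclic_ideal g
      & h = ('X^n - 1) %/ g].

End Codes.

Section MinimalPolynomial.

Variables (F : fieldType) (L : fieldExtType F).

Lemma minPoly_base_exists (x : L) :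
  exists p : {poly F}, map_poly (in_alg L) p == minPoly 1%AS x.
Proof.
by have /polyOver1P[p ->] := minPolyOver 1%AS x; exists p.
Qed.

(* The library's minPoly 1 x lives in {poly L}; this is the polynomial over F
   that it comes from (unique since F embeds in L). *)
Definition base_minPoly (x : L) : {poly F} := xchoose (minPoly_base_exists x).

Lemma base_minPolyE (x : L) :
  map_poly (in_alg L) (base_minPoly x) = minPoly 1%AS x.
Proof. exact/eqP/(xchooseP (minPoly_base_exists x)). Qed.

Definition generates_units (x : L) : Prop :=
  x != 0 /\ forall z : L, z != 0 -> exists i : int, z = x ^ i.

End MinimalPolynomial.

Section CodeD.

Variables (F : finFieldType) (L : fieldExtType F) (q m : nat) (pi : L).

(* For 1 < q the entries are pairwise distinct, so that a product over this
   sequence is the product over the underlying set. *)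
Definition Gamma : seq nat :=
  1%N :: [seq (q ^ (2 * i - 1) + 1)%N | i <- iota 1 m./2].

Definition h_poly : {poly F} := \prod_(u <- Gamma) base_minPoly (pi ^- u).

(* The ideal of the generator (x^n - 1) / h, for n = q^(2m) - 1. *)
Definition code_D : {set 'rV[F]_(q ^ (2 * m) - 1)} :=
  cyclic_ideal (q ^ (2 * m) - 1) (('X^(q ^ (2 * m) - 1) - 1) %/ h_poly).

End CodeD.

Section WeightTable.

Variables (q m : nat).
Let Q : rat := q%:R.

(* f_freq 0 = 1, both products being empty. *)
Definition f_freq (j : nat) : rat :=
  (\prod_(i < j) (((- Q) ^+ m - (- Q) ^+ i) / ((- Q) ^+ j - (- Q) ^+ i)))
  * \prod_(l < j) ((-1) ^+ m.+1 * Q ^+ m + (-1) ^+ l.+1 * Q ^+ l).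

(* Pairs (weight, frequency); iota 1 m is 1, ..., m. *)
Definition weight_table : seq (rat * rat) :=
  (0, 1)
  :: (Q ^+ (2 * m) - Q ^+ (2 * m - 1),
      Q ^+ (2 * m) - 1
      + \sum_(1 <= j < m.+1) (Q ^+ (2 * m) - Q ^+ (2 * j)) * f_freq j)
  :: [seq (Q ^+ (2 * m) - Q ^+ (2 * m - 1)
             - (-1) ^+ j * Q ^+ (2 * m - j - 1) * (Q - 1),
           (Q ^+ (2 * j - 1) + (-1) ^+ j * Q ^+ (j - 1) * (Q - 1)) * f_freq j)
     | j <- iota 1 m]
  ++ [seq (Q ^+ (2 * m) - Q ^+ (2 * m - 1) + (-1) ^+ j * Q ^+ (2 * m - j - 1),
           (Q ^+ (2 * j - 1) - (-1) ^+ j * Q ^+ (j - 1)) * (Q - 1) * f_freq j)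
     | j <- iota 1 m].

(* Entries of the table with equal weights are added up. *)
Definition table_count (w : nat) : rat :=
  \sum_(e <- weight_table | e.1 == w%:R) e.2.

End WeightTable.

(* Main.v *)
From HB Require Import structures.
From mathcomp Require Import all_boot all_order all_algebra.
From mathcomp Require Import all_fingroup all_solvable all_field.
From mathcomp Require Import ring lra zify.
Require Import Defs.

Set Implicit Arguments.
Unset Strict Implicit.
Unset Printing Implicit Defensive.

Import Order.TTheory GRing.Theory Num.Theory.
Local Open Scope ring_scope.

(** Let K be the subfield of order q^2 of L = F_(q^(2m)). The codewords are the
    words of values h_a(x) + Tr(x z) at the powers x of pi, with z in L and
    h_a(x) = Tr(sum_i a_i x^(q^(2i+1)+1)). As h_a(l x) = l^(q+1) h_a(x) for l in
    K, h_a is the quadratic form of a Hermitian form on the K-space L. Its polar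
    form is Tr(x adj_a(y)), so its radical is the K-subspace ker adj_a, and its
    rank j is the K-codimension of that kernel.

    Rank distribution. Adding one vector to a K-subspace U of dimension d divides
    the number of forms whose radical contains U by at most q^(2(m-d)-1). There
    are q^(m^2) forms, only the zero form has radical L, and these factors
    multiply up to q^(m^2) along a full flag, so each of them is exact. Double
    counting pairs (form, vector of its radical) then gives a recurrence that
    determines the number of forms of rank j.

    Weights. For a form of rank j with N zeros, the second moment of the fibre
    sizes yields (q N - |L|)^2, and the sign of q N - |L| is forced by
    q^2 - 1 | N - 1, because K^* acts freely on the nonzero zeros. If
    z = adj_a(y) then h_a(x) + Tr(x z) = h_a(x + y) - h_a(y); if z is not in the
    image of adj_a, then h_a(x) + Tr(x z) takes all values equally often.

    Identification of the code. Let h' = gcd(h, x^n - 1). At every nonzero point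
    of L either h' or the polynomial of a given trace codeword vanishes, so
    (x^n - 1) / h' divides that polynomial. The q^(m^2 + 2m) trace codewords are
    distinct, hence deg h' >= m^2 + 2m >= deg h and h' = h. *)

(** * Trace form of a finite field extension *)

Lemma card_additive_fiber (G H : finZmodType) (f : {additive G -> H})
    (D : {set G}) :
    (forall x y, x \in D -> y \in D -> x - y \in D) ->
  #|D| = (#|f @: D| * #|[set x in D | f x == 0%R]|)%N.
Proof.
move=> subD; rewrite -sum1_card (partition_big_imset f) /= -sum_nat_const.
apply: eq_bigr => y /imsetP[x0 Dx0 ->]; rewrite sum1dep_card.
have D0 : 0 \in D by rewrite -(subrr x0) subD.
have DN x : x \in D -> - x \in D by move=> Dx; rewrite -sub0r subD.
rewrite -[RHS](card_imset _ (addrI x0)); apply: eq_card => x; rewrite !inE.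
apply/idP/imsetP => [/andP[Dx /eqP fx] | [z /[!inE] /andP[Dz /eqP fz] ->]].
  exists (x - x0); last by rewrite addrC subrK.
  by rewrite inE subD //= raddfB fx subrr.
by rewrite -{1}[z]opprK subD ?DN //= raddfD fz addr0.
Qed.

(** Translation by [v (b - a)] embeds the fibre over a into the fibre over b, so all fibres have the
    same size. This is the tool for every equidistribution claim about a nonconstant affine function
    below. *)
Lemma card_shift_fiber (F : finFieldType) (V : finZmodType) (D : {set V})
    (phi : V -> F) (v : F -> V) :
    (forall x s, x \in D -> x + v s \in D) ->
    (forall x s, x \in D -> phi (x + v s) = phi x + s) ->
  forall c, (#|F| * #|[set x in D | phi x == c]|)%N = #|D|.
Proof.
move=> Dv phiv c.
have le_fib a b :
    (#|[set x in D | phi x == a]| <= #|[set x in D | phi x == b]|)%N.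
  rewrite -(card_imset _ (addIr (v (b - a)))); apply/subset_leq_card/subsetP.
  move=> _ /imsetP[x /[!inE] /andP[Dx /eqP phix] ->].
  by rewrite Dv //= phiv // phix addrC subrK.
rewrite -[RHS]sum1_card (partition_big phi predT) //=.
rewrite -sum_nat_const; apply: eq_bigr => a _.
by rewrite sum1dep_card; apply/eqP; rewrite eqn_leq !le_fib.
Qed.

Section FiniteExtension.

Variables (F : finFieldType) (L0 : fieldExtType F).
Local Notation L := (finvect_type L0).
Local Notation q := #|F|.
Local Notation s := (\dim {:L0}).
Implicit Types (x y z : L) (c : F).

Lemma card_finext : #|{: L}| = (q ^ s)%N.
Proof. by rewrite -(card_vspace {:L : vectType F}); apply: eq_card => x; rewrite memvf. Qed.

Lemma dim_finext_gt0 : (0 < s)%N.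
Proof. exact: (@adim_gt0 F L0). Qed.

Lemma q_gt1 : (1 < q)%N.
Proof. exact: finNzRing_gt1. Qed.

Lemma q_gt0 : (0 < q)%N.
Proof. exact: ltnW q_gt1. Qed.

Definition frob (i : nat) x : L := x ^+ (q ^ i).

Lemma frobD i : {morph frob i : x y / x + y}.
Proof.
move=> x y; rewrite /frob exprDn_pchar // (eq_pnat _ (pchar_lalg _)) pnatX.
have [p _ pchF] := finPcharP F; rewrite (eq_pnat _ (pcharf_eq pchF)) -cardsT.
have /abelian.abelem_pgroup := abelian.fin_ring_pchar_abelem pchF.
by rewrite /pgroup.pgroup => ->.
Qed.

Lemma frob0 i : frob i 0 = 0.
Proof. by rewrite /frob expr0n expn_eq0 -leqn0 leqNgt q_gt0. Qed.

Lemma frob_id x : frob 0 x = x.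
Proof. exact: expr1. Qed.

Lemma frobM i : {morph frob i : x y / x * y}.
Proof. by move=> x y; rewrite /frob exprMn. Qed.

Lemma frobB i : {morph frob i : x y / x - y}.
Proof. by move=> x y; apply: (addIr (frob i y)); rewrite -frobD !subrK. Qed.

Lemma frob_sum i I (r : seq I) P (E : I -> L) :
  frob i (\sum_(j <- r | P j) E j) = \sum_(j <- r | P j) frob i (E j).
Proof. exact: (big_morph _ (frobD i) (frob0 i)). Qed.

Lemma frob_scal i c : frob i c%:A = c%:A.
Proof.
rewrite /frob; elim: i => [|i IHi]; first by rewrite expr1.
by rewrite expnSr exprM IHi exprZn expr1n expf_card.
Qed.

Lemma frobK i j x : frob i (frob j x) = frob (j + i) x.
Proof. by rewrite /frob -exprM expnD. Qed.

Lemma frob_dim x : frob s x = x.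
Proof. by rewrite /frob -card_finext expf_card. Qed.

(** X^q - X already splits over F as the product of the X - c, so its roots in L are scalars. *)
Lemma frob1_fixed x : frob 1 x = x -> exists c, x = c%:A.
Proof.
rewrite /frob expn1 => xq.
have : root (map_poly (in_alg L) ('X^q - 'X)) x.
  by rewrite rmorphB /= map_polyXn map_polyX rootE !hornerE xq subrr.
rewrite finField_genPoly rmorph_prod rootE horner_prod => /prodf_eq0[c _].
by rewrite /= map_polyXsubC !hornerE subr_eq0 => /eqP ->; exists c.
Qed.

Definition trL x := \sum_(i < s) frob i x.

Lemma trL_frob i x : trL (frob i x) = trL x.
Proof.
elim: i => [|i IHi]; first by rewrite frob_id.
rewrite -IHi -[in LHS]addn1 -frobK; move: (frob i x) => y.
(* One Frobenius step permutes the conjugates cyclically: the last one, [frob s], comes back as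
   [frob 0]. *)
have s0 := dim_finext_gt0; rewrite /trL -(prednK s0) big_ord_recr big_ord_recl.
rewrite /= !frobK add1n prednK // frob_dim frob_id addrC; congr (_ + _).
by apply: eq_bigr => j _; rewrite frobK.
Qed.

Lemma trL_in x : exists c, c%:A == trL x.
Proof.
have [|c ->] := @frob1_fixed (trL x); last by exists c.
rewrite -[RHS](trL_frob 1) /trL frob_sum.
by apply: eq_bigr => i _; rewrite !frobK addnC.
Qed.

Definition tr x : F := xchoose (trL_in x).

Lemma trE x : (tr x)%:A = trL x.
Proof. exact/eqP/(xchooseP (trL_in x)). Qed.

Lemma scal_inj : injective (fun c => c%:A : L).
Proof. exact: fmorph_inj (in_alg L). Qed.

Lemma trD : {morph tr : x y / x + y}.
Proof.
move=> x y; apply: scal_inj; rewrite /= scalerDl !trE -big_split.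
by apply: eq_bigr => i _; rewrite /= frobD.
Qed.

Lemma trZ c x : tr (c *: x) = c * tr x.
Proof.
apply: scal_inj; rewrite /= -scalerA !trE scaler_sumr.
by apply: eq_bigr => i _; rewrite -[c *: x]mulr_algl frobM frob_scal mulr_algl.
Qed.

Lemma tr0 : tr 0 = 0.
Proof. by rewrite -[0 in LHS](scale0r (0 : L)) trZ mul0r. Qed.

Lemma trB x y : tr (x - y) = tr x - tr y.
Proof. by rewrite trD -scaleN1r trZ mulN1r. Qed.

Lemma tr_sum I (r : seq I) P (E : I -> L) :
  tr (\sum_(j <- r | P j) E j) = \sum_(j <- r | P j) tr (E j).
Proof. exact: (big_morph _ trD tr0). Qed.

Lemma tr_frob i x : tr (frob i x) = tr x.
Proof. by apply: scal_inj; rewrite /= !trE trL_frob. Qed.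

(* A nonzero polynomial with exponents q ^ i, i < s, has fewer roots than the
   q ^ s elements of L. *)
Lemma frob_free (a : 'I_s -> L) :
  (forall x, \sum_i a i * frob i x = 0) -> forall i, a i = 0.
Proof.
move=> a0 i; pose p : {poly L} := \sum_i a i *: 'X^(q ^ i).
have inj_exp (k l : 'I_s) : (q ^ k == q ^ l)%N = (k == l).
  by rewrite eqn_exp2l ?q_gt1.
have p0 : p = 0.
  apply/eqP/negPn/negP=> pN0; have := max_poly_roots pN0 _ (enum_uniq L).
  have -> : all (root p) (enum L).
    apply/allP=> x _; rewrite rootE horner_sum -[X in _ == X](a0 x).
    by apply/eqP/eq_bigr => j _; rewrite !hornerE.
  move=> /(_ isT); rewrite -cardE card_finext ltnNge => /negP[].
  apply: leq_trans (size_sum _ _ _) _; apply/bigmax_leqP => j _.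
  apply: leq_trans (size_scale_leq _ _) _.
  by rewrite size_polyXn ltn_exp2l ?q_gt1.
have : p`_(q ^ i) = 0 by rewrite p0 coef0.
rewrite coef_sum (bigD1 i) //= coefZ coefXn eqxx mulr1 big1 ?addr0 // => j ji.
by rewrite coefZ coefXn inj_exp eq_sym (negPf ji) mulr0.
Qed.

(** The hypothesis is a linear relation between the powers [frob i] with coefficients [frob i a]; by
    [frob_free] the coefficient at i = 0, which is a, vanishes. *)
Lemma tr_nondegenerate a : (forall x, tr (x * a) = 0) -> a = 0.
Proof.
move=> tra0; have := @frob_free (fun i => frob i a) _ (Ordinal dim_finext_gt0).
rewrite frob_id; apply=> x.
have := trE (x * a); rewrite tra0 scale0r => {2}->.
by apply: eq_bigr => i _; rewrite frobM mulrC.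
Qed.

Lemma tr_eq1 a : a != 0 -> exists x, tr (x * a) = 1.
Proof.
move=> aN0; suff [x xN0] : exists x, tr (x * a) != 0.
  by exists ((tr (x * a))^-1 *: x); rewrite -scalerAl trZ mulVf.
apply/existsP; apply: contraT; rewrite negb_exists => /forallP tra0.
case/negP: aN0; apply/eqP/tr_nondegenerate => x.
by have := tra0 x; rewrite negbK => /eqP.
Qed.

Definition annih (W : {vspace L}) : {set L} :=
  [set z | [forall x in W, tr (x * z) == 0]].

(* Double counting of the pairs (x, z) with x in W and tr (x z) = 0. *)
Lemma card_annih (W : {vspace L}) : (#|annih W| * q ^ \dim W = q ^ s)%N.
Proof.
pose WS := [set x in W]; pose P z x := tr (x * z) == 0.
have cW : #|WS| = (q ^ \dim W)%N by rewrite -card_vspace; apply: eq_card => x; rewrite inE.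
have E1 : (\sum_(x in WS) q * #|[set z in [set: L] | P z x]| =
           \sum_z q * #|[set x in WS | P z x]|)%N.
  rewrite -!big_distrr /=; congr (_ * _)%N.
  under eq_bigr do rewrite -sum1dep_card big_mkcond.
  under [RHS]eq_bigr do rewrite -sum1dep_card big_mkcondr /=.
  rewrite exchange_big /=; apply: eq_bigr => z _; apply: eq_bigr => x _.
  by rewrite inE.
(* The form x |-> tr (x z) is zero on W when z is in the annihilator, and equidistributed on W
   otherwise. The factor q on both sides of the count avoids division. *)
have E2 z : z \in annih W ->
    (q * #|[set x in WS | P z x]| = q * q ^ \dim W)%N.
  rewrite inE => /forall_inP zW; congr (_ * _)%N; rewrite -cW.
  by apply: eq_card => x; rewrite !inE; case: (boolP (x \in W)) => //= /zW.
have E3 z : z \notin annih W ->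
    (q * #|[set x in WS | P z x]| = q ^ \dim W)%N.
  rewrite inE negb_forall_in => /exists_inP[x0 Wx0 trN0].
  rewrite -cW; apply: (card_shift_fiber (v := fun s => (s / tr (x0 * z)) *: x0)).
    by move=> x c; rewrite !inE => Wx; rewrite memvD ?memvZ.
  by move=> x c _; rewrite mulrDl trD -scalerAl trZ divfK.
have E4 x : x != 0 -> (q * #|[set z in [set: L] | P z x]| = q ^ s)%N.
  move=> xN0; rewrite -card_finext -(cardsT L).
  have [y yx] := tr_eq1 xN0.
  apply: (card_shift_fiber (v := fun s => s *: y)) => [z c|z c _].
    by rewrite !inE.
  by rewrite mulrDr trD -scalerAr trZ mulrC [x * y]mulrC yx mulr1.
move: E1; rewrite (bigD1 0) ?inE ?mem0v //=.
have -> : #|[set z in [set: L] | P z 0]| = (q ^ s)%N.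
  by rewrite -card_finext -(cardsT L); apply: eq_card => z; rewrite !inE /P mul0r tr0 eqxx.
rewrite (eq_bigr (fun=> q ^ s)%N); last by move=> x /andP[_ /E4].
rewrite sum_nat_const (bigID [in annih W]) /=.
rewrite (eq_bigr _ E2) (eq_bigr _ E3) !sum_nat_const.
have -> : #|[pred x in WS | x != 0]| = (q ^ \dim W).-1.
  by rewrite -cW [in RHS](cardD1 0) !inE mem0v; apply: eq_card => x; rewrite !inE andbC.
have -> : #|[predC annih W]| = (q ^ s - #|annih W|)%N.
  by rewrite -card_finext -(cardC (mem (annih W))) addKn.
have: (0 < q ^ \dim W)%N by rewrite expn_gt0 q_gt0.
have: (#|annih W| <= q ^ s)%N by rewrite -card_finext max_card.
move: (#|annih W|) (q ^ \dim W)%N (q ^ s)%N q_gt1 => A w V q1 leA w0.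
case: w w0 => // w _ /=.
rewrite mulnBl => E.
have le1 : (A * w.+1 <= V * w.+1)%N by rewrite leq_mul2r leA orbT.
(* With |W| = w.+1, the double count reduces to (q - 1) A w.+1 = (q - 1) V. *)
apply/eqP; rewrite -(@eqn_pmul2l q.-1) ?ltn_predRL //; apply/eqP.
move: E; case: (q) q1 => // q' _ /=; nia.
Qed.

End FiniteExtension.

(** * Hermitian forms in trace representation *)

Section HermitianForms.

Variables (F : finFieldType) (L0 : fieldExtType F) (m : nat).
Hypothesis dimL : \dim {:L0} = (2 * m)%N.
Local Notation L := (finvect_type L0).
Local Notation q := #|F|.
Local Notation frob := (@frob F L0).
Local Notation tr := (@tr F L0).
Local Notation t := m./2.
Implicit Types (x y z : L) (c : F) (a b : 'rV[L]_t).

Lemma half_degree_gt0 : (0 < m)%N.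
Proof. by have := @dim_finext_gt0 F L0; rewrite dimL; case: (m). Qed.

Lemma card_ext : #|L| = (q ^ (2 * m))%N.
Proof. by rewrite card_finext dimL. Qed.

(** K is the fixed field of the square of a generator of the cyclic Galois group of order 2m. That
    square has order m, so K has degree 2 over F. *)
Lemma quadratic_subfield :
  exists K : {subfield L}, \dim K = 2%N /\ forall x, (x \in K) = (frob 2 x == x).
Proof.
have [al gen_al _] := finField_galois_generator (sub1v {:L}%AS).
have gal1 := finField_galois (sub1v {:L}%AS).
have oal : #[al]%g = (2 * m)%N.
  move/eqP: gen_al => gen_al; rewrite /fingroup.order -gen_al.
  by rewrite -(galois_dim gal1) dimv1 divn1.
have oal2 : #[(al ^+ 2)%g]%g = m.
  by rewrite cyclic.orderXdiv oal ?dvdn_mulr // mulKn.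
have := dim_fixedField <[(al ^+ 2)%g]>%G.
set K := fixedField_aspace <[(al ^+ 2)%g]>%G.
move=> cK; exists K.
have dK : \dim K = 2%N.
  have sK : (K <= {:L})%VS by rewrite subvf.
  have := dim_sup_field sK; rewrite -[X in (X * _)%N]cK.
  rewrite -[#|_|]/(#[(al ^+ 2)%g]%g) oal2 dimL => /eqP.
  by rewrite mulnC eqn_pmul2l ?half_degree_gt0 // => /eqP.
split=> // x; rewrite /frob -dK.
exact: Fermat's_little_theorem.
Qed.

Lemma half_lt (i : 'I_t) : (2 * i + 1 < m)%N.
Proof. by case: i => i /=; lia. Qed.

(** The exponents e and 2m - e give the same forms after conjugating inside the trace, so only odd e
    below m occur. They match the elements of [Gamma] other than 1. *)
Definition qform a x : F := tr (\sum_i a 0 i * (frob (2 * i + 1) x * x)).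

Definition adj a y : L :=
  \sum_i (a 0 i * frob (2 * i + 1) y
          + frob (2 * m - (2 * i + 1)) (a 0 i * y)).

Lemma qformD a x y : qform a (x + y) = qform a x + qform a y + tr (x * adj a y).
Proof.
rewrite /qform /adj mulr_sumr !tr_sum -!big_split; apply: eq_bigr => i _ /=.
have lei := half_lt i; rewrite frobD.
set e := (2 * i + 1)%N in lei *; set c := a 0 i.
have -> : tr (x * (c * frob e y + frob (2 * m - e) (c * y))) =
          tr (c * (frob e y * x)) + tr (c * (frob e x * y)).
  rewrite mulrDr trD; congr (tr _ + _); first by ring.
  (* Applying [frob (2m - e)] inside the trace turns [frob e x] back into x; this is the source of
     the second summand of [adj]. *)
  rewrite -(tr_frob (2 * m - e) (c * (frob e x * y))); congr (tr _).
  rewrite mulrCA [RHS]frobM frobK subnKC; last by lia.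
  by rewrite -dimL frob_dim.
rewrite -!trD; congr (tr _); ring.
Qed.

Lemma tr_adjC a x y : tr (x * adj a y) = tr (y * adj a x).
Proof.
apply: (addrI (qform a x + qform a y)).
by rewrite -qformD addrC qformD [qform a y + _]addrC.
Qed.

Lemma adj_is_linear a : linear (adj a).
Proof.
move=> c x y; rewrite /adj scaler_sumr -big_split; apply: eq_bigr => i _ /=.
rewrite !(frobM, frobD) -[c *: x]mulr_algl !frobM !frob_scal.
by rewrite -[c *: (_ + _)]mulr_algl; ring.
Qed.

HB.instance Definition _ a := GRing.isLinear.Build F L L *:%R (adj a) (adj_is_linear a).

(** The arguments of [adj] are swapped so that additivity in the form can be registered as a
    structure. *)
Definition adj_at y a := adj a y.

Lemma adj_at_is_zmod_morphism y : zmod_morphism (adj_at y).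
Proof.
move=> a b; rewrite /adj_at /adj -sumrB; apply: eq_bigr => i _ /=.
by rewrite !mxE !mulrBl frobB; ring.
Qed.

HB.instance Definition _ y :=
  GRing.isZmodMorphism.Build 'rV[L]_t L (adj_at y) (adj_at_is_zmod_morphism y).

Lemma adj_l0 y : adj 0 y = 0. Proof. exact: (raddf0 (adj_at y)). Qed.

Lemma adjlB a b y : adj (a - b) y = adj a y - adj b y.
Proof. exact: (raddfB (adj_at y)). Qed.

(** Since 2i + 1 < m, the exponents 2i + 1 and 2m - (2i + 1) are pairwise distinct and below 2m.
    Hence [frob_free] applies, and the coefficient at exponent 2i + 1 is exactly a_i. *)
Lemma adj_inj a : (forall y, adj a y = 0) -> a = 0.
Proof.
move=> adja0.
(* [b k] is the total coefficient of [frob k] in [adj a]. *)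
pose b (k : 'I_(\dim {:L0})) 
  := \sum_(i < t) ((k == (2 * i + 1)%N :> nat)%:R * a 0 i
   + (k == (2 * m - (2 * i + 1))%N :> nat)%:R * frob (2 * m - (2 * i + 1)) (a 0 i)).
have b0 : forall k, b k = 0.
  apply: (@frob_free _ L0) => y; rewrite -[RHS](adja0 y) /b.
  under eq_bigr do rewrite mulr_suml.
  rewrite exchange_big; apply: eq_bigr => i _ /=.
  have lti := half_lt i.
  have lt1 : (2 * i + 1 < \dim {:L0})%N by rewrite dimL; lia.
  have lt2 : (2 * m - (2 * i + 1) < \dim {:L0})%N by rewrite dimL; lia.
  under eq_bigr do rewrite mulrDl.
  rewrite big_split /= frobM; congr (_ + _).
    rewrite (bigD1 (Ordinal lt1)) //= eqxx mul1r big1 ?addr0 // => k kN.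
    by have /negPf -> : k != (2 * i + 1)%N :> nat; rewrite ?mul0r.
  rewrite (bigD1 (Ordinal lt2)) //= eqxx mul1r big1 ?addr0 // => k kN.
  by have /negPf -> : k != (2 * m - (2 * i + 1))%N :> nat; rewrite ?mul0r.
apply/rowP => i; rewrite mxE.
have lti := half_lt i.
have lt1 : (2 * i + 1 < \dim {:L0})%N by rewrite dimL; lia.
rewrite -[RHS](b0 (Ordinal lt1)) /b (bigD1 i) //= eqxx mul1r.
have -> : (2 * i + 1 == 2 * m - (2 * i + 1))%N = false by lia.
rewrite mul0r addr0 big1 ?addr0 // => j ji; have ltj := half_lt j.
have -> : (2 * i + 1 == 2 * j + 1)%N = false.
  by rewrite eqn_add2r eqn_pmul2l // eq_sym; apply: negPf.
have -> : (2 * i + 1 == 2 * m - (2 * j + 1))%N = false by lia.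
by rewrite !mul0r addr0.
Qed.

Definition rad a : {vspace L} := lker (linfun (adj a)).

Lemma mem_rad a y : (y \in rad a) = (adj a y == 0).
Proof. by rewrite memv_ker lfunE. Qed.

Lemma tr_adj_annih a x y : x \in rad a -> tr (x * adj a y) = 0.
Proof. by rewrite mem_rad tr_adjC => /eqP ->; rewrite mulr0 tr0. Qed.

(** * Semilinearity over the subfield of order q^2 *)

Section Subfield.

Variable K : {subfield L}.
Hypotheses (dimK : \dim K = 2%N) (memK : forall x, (x \in K) = (frob 2 x == x)).

Lemma frob_odd_K k x : x \in K -> frob (2 * k + 1) x = frob 1 x.
Proof.
rewrite memK => /eqP xK; elim: k => // k IHk.
have -> : (2 * k.+1 + 1 = 2 + (2 * k + 1))%N by lia.
by rewrite -frobK xK.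
Qed.

Lemma frob1_K x : x \in K -> frob 1 (frob 1 x) = x.
Proof. by rewrite memK frobK => /eqP. Qed.

Lemma frob1_in_K x : x \in K -> frob 1 x \in K.
Proof. by rewrite memK => /eqP Kx; rewrite memK frobK [(1 + 2)%N]addnC -frobK Kx. Qed.

(** All Frobenius exponents in [adj] are odd, so each of them acts on K as [frob 1]. *)
Lemma adjM a l y : l \in K -> adj a (l * y) = frob 1 l * adj a y.
Proof.
move=> Kl; rewrite /adj mulr_sumr; apply: eq_bigr => i _ /=.
have lti := half_lt i.
have -> : (2 * m - (2 * i + 1) = 2 * (m - i.+1) + 1)%N by lia.
by rewrite !frobM !(frob_odd_K _ Kl); ring.
Qed.

Lemma norm_trace_K l : l \in K ->
  exists2 c, c%:A = frob 1 l * l & exists d, d%:A = frob 1 l + l.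
Proof.
move=> Kl.
have [|c Ec] := @frob1_fixed _ _ (frob 1 l * l); first by rewrite frobM frob1_K // mulrC.
exists c => //.
have [|d Ed] := @frob1_fixed _ _ (frob 1 l + l); last by exists d.
by rewrite frobD frob1_K // addrC.
Qed.

Lemma qformM a l c y : l \in K -> c%:A = frob 1 l * l ->
  qform a (l * y) = c * qform a y.
Proof.
move=> Kl Ec; rewrite -trZ /qform; congr (tr _); rewrite scaler_sumr.
apply: eq_bigr => i _; rewrite frobM (frob_odd_K _ Kl) -[c *: _]mulr_algl Ec; ring.
Qed.

(** Expand h_a((l + 1) y) both by polarisation and by [qformM], using that the norm of l + 1 is the
    norm of l plus the trace of l plus 1. This ties the polar form to h_a in every
    characteristic. *)
Lemma qformMtr a l d y : l \in K -> d%:A = frob 1 l + l ->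
  tr (l * y * adj a y) = d * qform a y.
Proof.
move=> Kl Ed; have [c Ec _] := norm_trace_K Kl.
have frob11 : frob 1 1 = 1 by rewrite /frob expr1n.
have := qformD a (l * y) y; rewrite -{2}[y]mul1r -mulrDl.
rewrite (@qformM a (l + 1) (c + d + 1)) ?memvD ?rpred1 //; last first.
  by rewrite !scalerDl Ec Ed scale1r frobD frob11; ring.
by rewrite (qformM _ _ Kl Ec) => E; apply: (addrI (c * qform a y + qform a y)); rewrite -E; ring.
Qed.

Lemma nonfixed_K : exists2 l, l \in K & frob 1 l != l.
Proof.
apply/exists_inP; apply: contraT; rewrite negb_exists_in => /forall_inP fixK.
have : (K <= 1)%VS.
  apply/subvP => x /fixK; rewrite negbK => /eqP /frob1_fixed [c ->].
  by rewrite memvZ ?rpred1.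
by move/dimvS; rewrite dimK dimv1.
Qed.

Lemma trace0_K : exists2 l, l \in K & (l != 0) && (frob 1 l + l == 0).
Proof.
have [l Kl lN] := nonfixed_K; exists (frob 1 l - l).
  by rewrite memvB ?frob1_in_K.
by rewrite subr_eq0 lN frobB frob1_K // addrA subrK subrr eqxx.
Qed.

(** In odd characteristic 1 has trace 2; in characteristic 2 any l outside F works, since there -l =
    l. *)
Lemma trace_neq0_K : exists2 l, l \in K & frob 1 l + l != 0.
Proof.
have [] := eqVneq (1 + 1 : L) 0 => [two0|twoN0]; last first.
  by exists 1; rewrite ?rpred1 // /frob expr1n.
have [l Kl lN] := nonfixed_K; exists l => //; rewrite addr_eq0.
suff -> : - l = l by [].
by apply/eqP; rewrite eq_sym -addr_eq0 -[l]mul1r -mulrDl two0 mul0r.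
Qed.

(** In characteristic 2 a quadratic form may be nonzero on the radical of its polar form. Here
    [qformMtr] with an l of nonzero trace excludes this. *)
Lemma qform_rad a y : y \in rad a -> qform a y = 0.
Proof.
rewrite mem_rad => /eqP ay0; have [l Kl lN] := trace_neq0_K.
have [_ _ [d Ed]] := norm_trace_K Kl.
have := qformMtr a y Kl Ed; rewrite ay0 mulr0 tr0 => /esym/eqP.
rewrite mulf_eq0 => /orP[/eqP d0|/eqP//].
by move: lN; rewrite -Ed d0 scale0r eqxx.
Qed.

Lemma rad_module a : (K * rad a <= rad a)%VS.
Proof.
apply/prodvP => l y Kl; rewrite !mem_rad adjM // => /eqP ->.
by rewrite mulr0.
Qed.

Lemma module_mulr (U : {vspace L}) l u :
  (K * U <= U)%VS -> l \in K -> l != 0 -> (l * u \in U) = (u \in U).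
Proof.
move=> modU Kl lN0; apply/idP/idP => Uu; last exact: (prodvP modU).
by rewrite -[u](mulKf lN0) (prodvP modU) ?rpredV.
Qed.

Lemma dim_module_addline (U : {vspace L}) u : (K * U <= U)%VS -> u \notin U ->
  \dim (U + K * <[u]>) = (\dim U + 2)%N.
Proof.
move=> modU uN; rewrite dimv_disjoint_sum; last first.
  apply/eqP; rewrite -subv0; apply/subvP => x; rewrite memv_cap memv0.
  case/andP => Ux /memv_cosetP[l Kl def_x].
  have [l0|lN0] := eqVneq l 0; first by rewrite def_x l0 mul0r.
  by move: Ux; rewrite def_x module_mulr // (negPf uN).
have uN0 : u != 0 by apply: contraNneq uN => ->; rewrite mem0v.
by rewrite dim_cosetv ?dimK.
Qed.

Lemma addline_module (U : {vspace L}) u : (K * U <= U)%VS ->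
  (K * (U + K * <[u]>) <= U + K * <[u]>)%VS.
Proof.
by move=> modU; rewrite prodvDr addvS // prodvA prodvSl // prodv_id.
Qed.

Lemma addline_sub (U V : {vspace L}) u : (K * V <= V)%VS ->
  (U + K * <[u]> <= V)%VS = (U <= V)%VS && (u \in V).
Proof.
move=> modV; rewrite subv_add; congr andb; apply/idP/idP => [sV|Vu].
  by apply: (subvP sV); rewrite -[X in X \in _]mul1r memv_mul ?rpred1 ?memv_line.
by apply/subvP => _ /memv_cosetP[l Kl ->]; apply: (prodvP modV).
Qed.

Definition forms_above (U : {vspace L}) := [set a | (U <= rad a)%VS].

(** Evaluate a |-> [adj a u] on the forms above U. Its kernel consists of the forms above U + K u.
    Its values are trace-orthogonal to U, and also to [l0 * u] for l0 of trace 0, by [qformMtr]; so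
    they lie in the annihilator of an F-space of dimension 2d + 1. *)
Lemma card_forms_above_step (U : {vspace L}) u d :
    (K * U <= U)%VS -> \dim U = (2 * d)%N -> u \notin U ->
  (#|forms_above U| <=
     q ^ (2 * (m - d) - 1) * #|forms_above (U + K * <[u]>)|)%N.
Proof.
move=> modU dimU uN.
rewrite (card_additive_fiber (adj_at u)); last first.
  move=> a b; rewrite !inE => /subvP aU /subvP bU; apply/subvP => x Ux.
  rewrite mem_rad adjlB.
  move: (aU x Ux) (bU x Ux); rewrite !mem_rad => /eqP E1 /eqP E2.
  by rewrite E1 E2 subrr.
have [l0 Kl0 /andP[l0N0 /eqP tr0]] := trace0_K.
have l0uN : l0 * u \notin U by rewrite module_mulr.
pose W := (U + <[l0 * u]>)%VS.
have dimW : \dim W = (2 * d + 1)%N.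
  rewrite dimv_disjoint_sum ?dimU ?dim_vline.
    by rewrite (contraNneq _ l0uN) // => ->; rewrite mem0v.
  apply/eqP; rewrite -subv0; apply/subvP => x; rewrite memv_cap memv0.
  case/andP => Ux /vlineP[c def_x].
  have [c0|cN0] := eqVneq c 0; first by rewrite def_x c0 scale0r.
  by move: Ux; rewrite def_x rpredZeq (negPf cN0) (negPf l0uN).
have dW : (2 * d + 1 <= 2 * m)%N.
  by rewrite -dimW -dimL; apply: (dimvS (subvf W)).
have cW : #|annih W| = (q ^ (2 * (m - d) - 1))%N.
  have := card_annih W; rewrite dimW dimL.
  have -> : (2 * m = (2 * (m - d) - 1) + (2 * d + 1))%N by lia.
  by rewrite [RHS]expnD => /eqP; rewrite eqn_pmul2r ?expn_gt0 ?q_gt0 // => /eqP.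
apply: leq_mul.
  rewrite -cW; apply/subset_leq_card/subsetP => _ /imsetP[a /[!inE] aU ->].
  apply/forall_inP => x /memv_addP[y Uy [_ /vlineP[c ->] ->]].
  rewrite mulrDl trD -scalerAl trZ tr_adj_annih ?(subvP aU) //.
  by rewrite (@qformMtr _ l0 0) ?scale0r ?tr0 // mul0r mulr0 addr0.
apply/subset_leq_card/subsetP => a; rewrite !inE => /andP[aU au0].
by rewrite addline_sub ?rad_module // aU mem_rad.
Qed.

End Subfield.

End HermitianForms.

(** * The rank polynomials *)

Section RankPolynomials.

Variables (R : fieldType) (b : R).
Hypotheses (b0 : b != 0) (b1 : forall k, b ^+ k.+1 != 1).
Implicit Types (j n : nat) (Y : R).

Definition rank_num j Y := \prod_(l < j) (Y - b ^+ (2 * l)).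
Definition rank_den j := \prod_(l < j) (b ^+ l - b ^+ j).
(** For b = -q, the value at Y = b^(2n) will be the number of forms of rank j above a K-subspace of
    K-codimension n; keeping Y variable permits induction on n. *)
Definition rank_poly j Y := rank_num j Y / rank_den j.

Lemma rank_numS j Y : rank_num j.+1 Y = rank_num j Y * (Y - b ^+ (2 * j)).
Proof. by rewrite /rank_num big_ord_recr. Qed.

Lemma rank_num_shift j Y :
  rank_num j.+1 (b ^+ 2 * Y) = (b ^+ 2 * Y - 1) * b ^+ (2 * j) * rank_num j Y.
Proof.
rewrite /rank_num big_ord_recl muln0 expr0 -mulrA; congr (_ * _).
have -> : b ^+ (2 * j) = \prod_(i < j) b ^+ 2 by rewrite prodr_const card_ord exprM.
rewrite -big_split; apply: eq_bigr => i _.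
by rewrite /= /bump add1n mulnS exprD mulrBr.
Qed.

Lemma rank_denS j : rank_den j.+1 = (1 - b ^+ j.+1) * b ^+ j * rank_den j.
Proof.
rewrite /rank_den big_ord_recl expr0 -mulrA; congr (_ * _).
have {1}-> : b ^+ j = \prod_(i < j) b by rewrite prodr_const card_ord.
rewrite -big_split; apply: eq_bigr => i _.
by rewrite /= /bump add1n !exprS mulrBr.
Qed.

Lemma rank_den_neq0 j : rank_den j != 0.
Proof.
elim: j => [|j IHj]; first by rewrite /rank_den big_ord0 oner_eq0.
by rewrite rank_denS !mulf_neq0 ?expf_neq0 // subr_eq0 eq_sym.
Qed.

Lemma rank_poly0 Y : rank_poly 0 Y = 1.
Proof. by rewrite /rank_poly /rank_num /rank_den !big_ord0 divr1. Qed.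

Lemma rank_poly_vanish j n : (n < j)%N -> rank_poly j (b ^+ (2 * n)) = 0.
Proof.
move=> nj; apply/eqP; rewrite mulf_eq0; apply/orP; left.
by apply/prodf_eq0; exists (Ordinal nj); rewrite // subrr.
Qed.

Lemma rank_poly_shift j Y : (b ^+ 2 * Y - b ^+ (2 * j)) * rank_poly j (b ^+ 2 * Y) =
  (b ^+ 2 * Y - 1) * b ^+ (2 * j) * rank_poly j Y.
Proof. by rewrite /rank_poly !mulrA -rank_num_shift rank_numS; congr (_ / _); ring. Qed.

(** This combination has partial sums in closed form. At Y = b^(2n), taken up to j = n + 1, the
    right-hand side vanishes, which expresses the full sum for n + 1 as -b^(2n+1) times the one for
    n. *)
Lemma rank_poly_telescope Y n :
  \sum_(j < n.+1) (rank_poly j (b ^+ 2 * Y) + b * Y * rank_poly j Y) =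
  (b * Y + b ^+ n) * rank_poly n Y.
Proof.
elim: n => [|n IHn]; first by rewrite big_ord1 !rank_poly0; ring.
rewrite big_ord_recr /= {}IHn /rank_poly rank_num_shift rank_numS rank_denS.
have d0 := rank_den_neq0 n; have bn0 : b ^+ n != 0 by rewrite expf_neq0.
have b1n : 1 - b ^+ n.+1 != 0 by rewrite subr_eq0 eq_sym.
move: b1n; rewrite mulnC exprM !exprS => b1n.
by field; rewrite d0 bn0.
Qed.

Lemma sum_rank_poly n :
  \sum_(j < n.+1) rank_poly j (b ^+ (2 * n)) = (-1) ^+ n * b ^+ (n ^ 2).
Proof.
elim: n => [|n IHn]; first by rewrite big_ord1 rank_poly0 !expr0 mulr1.
have := rank_poly_telescope (b ^+ (2 * n)) n.+1.
rewrite rank_poly_vanish // mulr0 big_split /= -exprD -mulnS => /eqP.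
rewrite addr_eq0 => /eqP ->.
rewrite -mulr_sumr big_ord_recr /= rank_poly_vanish // addr0 IHn.
have -> : (n.+1 ^ 2 = n ^ 2 + (2 * n).+1)%N by lia.
by rewrite exprD !exprS; ring.
Qed.

End RankPolynomials.

(** With b = -q the factors of the second product are -(b^m + b^l); paired with b^m - b^l they give
    the differences b^(2m) - b^(2l), and the sign is absorbed by the denominator. *)
Lemma f_freqE q m j : f_freq q m j = rank_poly (- q%:R) j ((- q%:R) ^+ (2 * m)).
Proof.
rewrite /f_freq /rank_poly /rank_num /rank_den -prodf_div -big_split.
apply: eq_bigr => l _ /=; set Q : rat := q%:R.
have E k : (-1) ^+ k.+1 * Q ^+ k = - (- Q) ^+ k.
  by rewrite exprS mulN1r mulNr -exprMn mulN1r.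
rewrite !E ![(2 * _)%N]mulnC !exprM -[(_ ^+ l - _)]opprB invrN; ring.
Qed.

(** * Rank distribution *)

Section RankDistribution.

Variables (F : finFieldType) (L0 : fieldExtType F) (m : nat).
Hypotheses (dimL : \dim {:L0} = (2 * m)%N) (m_even : ~~ odd m).
Local Notation L := (finvect_type L0).
Local Notation q := #|F|.
Local Notation t := m./2.
Variable K : {subfield L}.
Hypotheses (dimK : \dim K = 2%N) (memK : forall x, (x \in K) = (frob 2 x == x)).
Implicit Types (U V W : {vspace L}) (a : 'rV[L]_t).

Lemma module_dim U : (K * U <= U)%VS -> exists2 d, \dim U = (2 * d)%N & (d <= m)%N.
Proof.
move=> modU; have [d Ed] := dvdnP (field_module_dimS modU).
exists d; first by rewrite Ed dimK mulnC.
have := dimvS (subvf U); rewrite Ed dimK -[\dim fullv]/(\dim {:L0}) dimL; lia.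
Qed.

(** Iterates [card_forms_above_step] along a flag of K-subspaces from W to U. The exponents 2(m - c)
    - 1 are consecutive odd numbers, hence differences of squares. *)
Lemma card_forms_above_mono W U c d :
    (K * W <= W)%VS -> (K * U <= U)%VS -> (W <= U)%VS ->
    \dim W = (2 * c)%N -> \dim U = (2 * d)%N ->
  (#|forms_above m W| * q ^ ((m - d) ^ 2) <=
     q ^ ((m - c) ^ 2) * #|forms_above m U|)%N.
Proof.
move=> + modU + + dimU; have [k] := ubnP (d - c)%N.
elim: k W c => // k IHk W c le_k modW sWU dimW.
have le_cd : (c <= d)%N by have := dimvS sWU; rewrite dimW dimU leq_pmul2l.
have [sUW|] := boolP (U <= W)%VS.
  have eqWU : W = U by apply/eqP; rewrite eqEsubv sWU.
  by move: dimW; rewrite eqWU dimU => /eqP; rewrite eqn_pmul2l // => /eqP ->; rewrite mulnC.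
case/subvPn => u Uu uW.
have dimW' := dim_module_addline dimK modW uW.
have sW'U : (W + K * <[u]> <= U)%VS by rewrite addline_sub ?sWU.
have ltcd : (c < d)%N.
  by have := dimvS sW'U; rewrite dimW' dimW dimU; lia.
have le_dm : (d <= m)%N.
  have := dimvS (subvf U); rewrite dimU -[\dim fullv]/(\dim {:L0}) dimL; lia.
have IH : (#|forms_above m (W + K * <[u]>)| * q ^ ((m - d) ^ 2) <=
           q ^ ((m - c.+1) ^ 2) * #|forms_above m U|)%N.
  by apply: IHk; rewrite ?addline_module // ?dimW' ?dimW; lia.
have step := card_forms_above_step dimL dimK memK modW dimW uW.
apply: leq_trans (leq_mul step (leqnn _)) _; rewrite -mulnA.
have -> : ((m - c) ^ 2 = (2 * (m - c) - 1) + (m - c.+1) ^ 2)%N.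
  have -> : (m - c = (m - c.+1).+1)%N by lia.
  by move: (m - c.+1)%N => x; lia.
by rewrite expnD -mulnA leq_pmul2l ?expn_gt0 ?q_gt0.
Qed.

Lemma card_forms_above_full : #|forms_above m {:L}| = 1%N.
Proof.
rewrite (eq_card (B := [set 0])) ?cards1 // => a; rewrite !inE; apply/idP/eqP.
  move/subvP => aL; apply: (adj_inj dimL) => y; apply/eqP.
  by rewrite -mem_rad aL ?memvf.
by move=> ->; apply/subvP => y _; rewrite mem_rad adj_l0.
Qed.

Lemma card_forms_above_0 : #|forms_above m (0 : {vspace L})| = (q ^ (m ^ 2))%N.
Proof.
transitivity #|{: 'rV[L]_t}|.
  by rewrite -cardsT; apply: eq_card => a; rewrite !inE sub0v.
rewrite card_mx mul1n card_finext dimL -expnM; congr (_ ^ _)%N.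
have := odd_double_half m; rewrite (negPf m_even) add0n -muln2.
by move: m./2 => k <-; lia.
Qed.

(** The flag from U to L gives the upper bound and the flag from 0 to U the lower one; they agree
    because there are q^(m^2) forms in all and a single one above L. *)
Lemma card_forms_above U d : (K * U <= U)%VS -> \dim U = (2 * d)%N ->
  #|forms_above m U| = (q ^ ((m - d) ^ 2))%N.
Proof.
move=> modU dimU; apply/eqP; rewrite eqn_leq; apply/andP; split.
  have := card_forms_above_mono modU (subvf _) (subvf U) dimU dimL.
  by rewrite card_forms_above_full subnn !muln1.
have := @card_forms_above_mono 0%VS U 0 d _ modU (sub0v _) _ dimU.
rewrite prodv0 sub0v dimv0 muln0 => /(_ isT erefl).
by rewrite card_forms_above_0 subn0 leq_pmul2l ?expn_gt0 ?q_gt0.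
Qed.

Local Notation b := (- (q%:R : rat)).

Lemma b_neq0 : b != 0.
Proof. by rewrite oppr_eq0 pnatr_eq0 -lt0n q_gt0. Qed.

Lemma b_exp_neq1 k : b ^+ k.+1 != 1.
Proof.
apply/negP => /eqP /(congr1 Num.norm); rewrite normrX normrN normr1 normr_nat.
apply/eqP; rewrite gt_eqF // exprn_egt1 // ?ltr1n ?q_gt1 //.
Qed.

Lemma b_sqr k : b ^+ (2 * k) = (q ^ (2 * k))%:R.
Proof. by rewrite exprM sqrrN -exprM natrX. Qed.

Definition forms_rank U j :=
  [set a in forms_above m U | \dim (rad a) == (2 * (m - j))%N].

Lemma forms_rank_double_count U j :
    (K * U <= U)%VS -> (j <= m)%N ->
  (\sum_(u | u \notin U) #|forms_rank (U + K * <[u]>) j| =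
   #|forms_rank U j| * (q ^ (2 * (m - j)) - q ^ \dim U))%N.
Proof.
move=> modU le_jm.
under eq_bigr do rewrite -sum1_card big_mkcond.
rewrite exchange_big /= -sum_nat_const [RHS]big_mkcond; apply: eq_bigr => a _ /=.
(* For a fixed form above U, the admissible u are the elements of its radical outside U. *)
transitivity (\sum_(u | (u \in rad a) && (u \notin U)) (a \in forms_rank U j : nat))%N.
  rewrite -big_mkcondl [LHS]big_mkcond [RHS]big_mkcond /=; apply: eq_bigr => u _.
  rewrite !inE (addline_sub _ _ (rad_module dimL dimK memK a)) //.
  by case: (U <= rad a)%VS; case: (u \in rad a); case: (u \in U); case: (_ == _).
rewrite sum_nat_const; case: ifP => aU; rewrite ?muln0 // muln1.
move: aU; rewrite !inE => /andP[/subvP sU /eqP dim_a].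
rewrite -dim_a -!card_vspace -(cardID (mem U) (mem (rad a))).
rewrite (eq_card (A := [predI mem (rad a) & mem U]) (B := mem U)); last first.
  by move=> u; rewrite !inE; case: (boolP (u \in U)) => [/sU ->|]; rewrite ?andbF.
by rewrite addKn; apply: eq_card => u; rewrite !inE andbC.
Qed.

Lemma sum_card_forms_rank U n : (K * U <= U)%VS -> (n <= m)%N ->
    \dim U = (2 * (m - n))%N ->
  (\sum_(j < n.+1) #|forms_rank U j| = q ^ (n ^ 2))%N.
Proof.
move=> modU le_nm dimU; have := card_forms_above modU dimU; rewrite subKn // => <-.
under eq_bigr do rewrite -sum1_card big_mkcond.
rewrite exchange_big /= -sum1_card [RHS]big_mkcond; apply: eq_bigr => a _ /=.
case: ifP => aU; last by rewrite big1 // => j _; rewrite inE aU.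
have [d dim_a le_dm] := module_dim (rad_module dimL dimK memK a).
have le_nd : (m - n <= d)%N.
  by move: aU; rewrite inE => /dimvS; rewrite dim_a dimU leq_pmul2l.
have lt_j : (m - d < n.+1)%N by lia.
rewrite (bigD1 (Ordinal lt_j)) //= inE aU dim_a subKn // eqxx big1 // => j jN.
rewrite inE aU dim_a /= eqn_pmul2l //; case: eqP => // Ed.
by case/eqP: jN; apply: val_inj => /=; have := ltn_ord j; lia.
Qed.

(** Induction on the K-codimension n of U. For codimension n + 1 and j <= n, the double count and
    [rank_poly_shift] give the same linear equation with a nonzero leading factor. For j = n + 1
    that factor is zero, and the count follows from the total over all ranks. *)
Lemma card_forms_rank U j n : (K * U <= U)%VS -> (n <= m)%N ->
    \dim U = (2 * (m - n))%N -> (j <= m)%N ->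
  #|forms_rank U j|%:R = rank_poly b j (b ^+ (2 * n)).
Proof.
elim: n U j => [|n IHn] U j modU le_nm dimU le_jm.
  have [->|j0] := posnP j; last first.
    rewrite rank_poly_vanish // (_ : forms_rank _ _ = set0) ?cards0 //.
    apply/setP => a; rewrite !inE; apply/negbTE/negP => /andP[/dimvS + /eqP E].
    by rewrite E dimU; lia.
  have := sum_card_forms_rank modU le_nm dimU; rewrite big_ord1 => ->.
  by rewrite muln0 rank_poly0.
have rank_lt i : (i < n.+1)%N ->
    #|forms_rank U i|%:R = rank_poly b i (b ^+ (2 * n.+1)).
  move=> lt_in; have le_im : (i <= m)%N by lia.
  have /(congr1 (fun k => k%:R : rat)) := forms_rank_double_count modU le_im.
  rewrite natr_sum (eq_bigr (fun=> rank_poly b i (b ^+ (2 * n)))); last first.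
    move=> u uN; apply: IHn; rewrite ?addline_module //; first by lia.
    by rewrite (dim_module_addline dimK modU uN) dimU; lia.
  rewrite sumr_const (eq_card (B := [predC U])) => [|u]; last by rewrite !inE.
  have -> : #|[predC U]| = (q ^ (2 * m) - q ^ (2 * (m - n.+1)))%N.
    rewrite -dimU -card_vspace -dimL -(card_finext L0) -(cardC (mem U)) addKn.
    by apply: eq_card => u; rewrite !inE.
  rewrite dimU -[rank_poly _ _ _ *+ _]mulr_natr natrM !natrB ?leq_exp2l ?q_gt1 //; try lia.
  rewrite -!b_sqr => E.
  have shift := rank_poly_shift b i (b ^+ (2 * n)).
  rewrite -exprD -mulnS in shift.
  have b0 := b_neq0.
  pose c := b ^+ (2 * (m - n.+1)).
  have c0 : c != 0 by rewrite expf_neq0.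
  pose e := b ^+ (2 * i).
  have e0 : e != 0 by rewrite expf_neq0.
  have Em : b ^+ (2 * m) = c * b ^+ (2 * n.+1).
    by rewrite -exprD; congr (_ ^+ _); lia.
  have Ei : b ^+ (2 * (m - i)) * e = c * b ^+ (2 * n.+1).
    by rewrite -!exprD; congr (_ ^+ _); lia.
  have ne : b ^+ (2 * n.+1) - e != 0.
    (* The remaining exponent is written as a successor to match [b_exp_neq1]. *)
    rewrite subr_eq0 (_ : 2 * n.+1 = 2 * i + (2 * (n - i) + 1).+1)%N; last by lia.
    by rewrite exprD -/e -{2}[e]mulr1 (inj_eq (mulfI e0)) b_exp_neq1.
  have {}shift : (b ^+ (2 * n.+1) - e) * rank_poly b i (b ^+ (2 * n.+1)) =
      (b ^+ (2 * n.+1) - 1) * e * rank_poly b i (b ^+ (2 * n)) by exact: shift.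
  apply: (mulfI ne). rewrite shift; apply: (mulfI c0).
  set r := #|_|%:R in E *; set M := b ^+ (2 * (m - i)) in E Ei.
  set P := rank_poly _ _ _ in E *.
  have {}E : P * (b ^+ (2 * m) - c) = r * (M - c) by exact: E.
  transitivity (r * (M * e) - r * c * e); first by rewrite Ei; ring.
  transitivity (r * (M - c) * e); first by ring.
  by rewrite -E Em; ring.
have [lt_jn|lt_nj|->] := ltngtP j n.+1.
- exact: rank_lt.
- rewrite rank_poly_vanish // (_ : forms_rank _ _ = set0) ?cards0 //.
  apply/setP => a; rewrite !inE; apply/negbTE/negP => /andP[/dimvS + /eqP E].
  by rewrite E dimU; lia.
have /(congr1 (fun k => k%:R : rat)) := sum_card_forms_rank modU le_nm dimU.
rewrite natr_sum big_ord_recr /=.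
rewrite (eq_bigr (fun i : 'I_n.+1 => rank_poly b i (b ^+ (2 * n.+1)))); last first.
  by move=> i _; apply: rank_lt.
have := sum_rank_poly b_neq0 b_exp_neq1 n.+1; rewrite big_ord_recr /=.
have -> : (-1) ^+ n.+1 * b ^+ (n.+1 ^ 2) = (q ^ (n.+1 ^ 2))%:R.
  rewrite [b ^+ _]exprNn mulrA -exprD -natrX -signr_odd.
  by rewrite oddD oddX /=; case: odd; rewrite mul1r.
by move=> <- /addrI.
Qed.

End RankDistribution.

(** * Zeros of a form plus a linear functional *)

Lemma sum_additive_fiber (G H : finZmodType) (f : {additive G -> H}) (R : pzRingType)
    (g : H -> R) :
  \sum_x g (f x) = #|[set x | f x == 0%R]|%:R * \sum_(y in f @: [set: G]) g y.
Proof.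
rewrite (eq_bigl [in [set: G]]) => [|x]; last by rewrite inE.
rewrite (partition_big_imset f) /= mulr_sumr.
apply: eq_bigr => y /imsetP[x0 _ ->].
rewrite (eq_bigr (fun=> g (f x0))) => [|x /andP[_ /eqP -> //]].
rewrite sumr_const mulr_natl; congr (_ *+ _).
rewrite -[RHS](card_imset _ (addrI x0)); apply: eq_card => x; rewrite unfold_in !inE.
apply/idP/imsetP => [/eqP fx | [z /[!inE] /eqP fz ->]].
  by exists (x - x0); rewrite ?inE ?raddfB ?fx ?subrr // addrC subrK.
by rewrite raddfD fz addr0 eqxx.
Qed.

Section Zeros.

Variables (F : finFieldType) (L0 : fieldExtType F) (m : nat).
Hypothesis dimL : \dim {:L0} = (2 * m)%N.
Local Notation L := (finvect_type L0).
Local Notation q := #|F|.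
Local Notation t := m./2.
Variable K : {subfield L}.
Hypotheses (dimK : \dim K = 2%N) (memK : forall x, (x \in K) = (frob 2 x == x)).

Implicit Types (x y z : L) (c d : F).

Lemma card_K : #|K| = (q ^ 2)%N.
Proof. by rewrite card_vspace dimK. Qed.

(** Each norm fibre has at most q + 1 elements, being roots of X^(q+1) - d. If c were missed, the
    other q - 2 nonzero values would cover at most (q - 2)(q + 1) < q^2 - 1 elements of K. *)
Lemma norm_K_surj c : c != 0 -> exists2 l, l \in K & c%:A = frob 1 l * l.
Proof.
move=> cN0; pose fib d := [set l in K | frob 1 l * l == d%:A].
have card_fib d : (#|fib d| <= q.+1)%N.
  pose p : {poly L} := 'X^(q.+1) - (d%:A)%:P.
  have szp : size p = q.+2 by rewrite size_XnsubC.
  rewrite cardE -ltnS -szp; apply: max_poly_roots (enum_uniq _).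
    by rewrite -size_poly_eq0 szp.
  apply/allP => l; rewrite mem_enum inE => /andP[_ /eqP El].
  by rewrite rootE !hornerE exprSr -El /frob expn1 subrr.
have cK : (\sum_(d | d != 0%R) #|fib d| = (q ^ 2).-1)%N.
  rewrite -card_K (cardD1 0) mem0v /= -sum1_card.
  (* The default 0 is never reached for l in K, where the norm is a scalar. *)
  pose nrm (l : L) : F := odflt 0 [pick d | frob 1 l * l == d%:A].
  have nrmE l : l \in K -> (nrm l)%:A = frob 1 l * l.
    move=> Kl; rewrite /nrm; case: pickP => [d /eqP -> //|].
    by have [d Ed _] := norm_trace_K memK Kl; move/(_ d); rewrite Ed eqxx.
  rewrite (partition_big nrm (fun d => d != 0)) /= => [|l].
    apply: eq_bigr => d dN0; rewrite sum1dep_card; apply: eq_card => l; rewrite !inE.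
    case: (boolP (l \in K)) => Kl; rewrite ?andbF //= andbT.
    rewrite -nrmE // (inj_eq (@scal_inj _ L0)); case: eqP => [El|]; rewrite ?andbF // andbT.
    apply/esym/eqP => l0; case/eqP: dN0; apply: (@scal_inj _ L0).
    by rewrite /= -El nrmE // l0 mulr0 scale0r.
  rewrite !inE => /andP[lN0 Kl]; apply/eqP => nrm0.
  have := nrmE l Kl; rewrite nrm0 scale0r => /esym/eqP.
  by rewrite mulf_eq0 /frob expf_eq0 (negPf lN0) andbF.
have [/eqP fib0|] := boolP (#|fib c| == 0%N); last first.
  rewrite -lt0n card_gt0 => /set0Pn[l]; rewrite inE => /andP[Kl /eqP El].
  by exists l.
have := cK; rewrite (bigD1 c) //= fib0 add0n => E.
have : ((q ^ 2).-1 <= (q - 2) * q.+1)%N.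
  rewrite -E -[(q - 2)%N](_ : #|[pred d : F | (d != 0) && (d != c)]| = _).
    by rewrite -sum_nat_const; apply: leq_sum.
  rewrite [in RHS](cardD1 0) [in RHS](cardD1 c) !inE cN0 /= !add1n subn2 /=; apply: eq_card => d.
  by rewrite !inE andbT andbC.
by have := q_gt1 F; nia.
Qed.

(** A is partitioned into orbits of the free action of K^*, that is, into classes of the relation y
    / x in K, each of size q^2 - 1. *)
Lemma card_K_invariant (A : {set L}) :
    0 \notin A -> (forall l x, l \in K -> l != 0 -> x \in A -> l * x \in A) ->
  ((q ^ 2).-1 %| #|A|)%N.
Proof.
move=> A0 KA; pose r (x y : L) := y / x \in K.
have nz x : x \in A -> x != 0 by apply: contraTneq => ->.
have eqr : {in A & &, equivalence_rel r}.
  move=> x y z Ax Ay Az; split; rewrite /r ?divff ?rpred1 ?nz // => Kyx.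
  have -> : z / x = (z / y) * (y / x).
    by field; rewrite !nz.
  by rewrite fpredMr // mulf_neq0 ?invr_neq0 ?nz.
have := card_uniform_partition _ (equivalence_partitionP eqr).
move=> /(_ (q ^ 2).-1) ->; first exact: dvdn_mull.
move=> _ /imsetP[x Ax ->]; rewrite -card_K [in RHS](cardD1 0) mem0v /=.
rewrite -[RHS](card_imset _ (mulIf (nz x Ax))); apply: eq_card => y; rewrite !inE.
apply/andP/imsetP => [[Ay rxy]|[l /[!inE] /andP[lN0 Kl] ->]].
  exists (y / x); last by rewrite divfK ?nz.
  by rewrite !inE mulf_neq0 ?invr_neq0 ?nz.
by split; [apply: KA | rewrite /r mulfK ?nz].
Qed.

(** * Level sets of one form of rank j *)

Section OneForm.

Variables (a : 'rV[L]_t) (j : nat).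
Hypotheses (le_jm : (j <= m)%N) (dim_a : \dim (rad a) = (2 * (m - j))%N).

Local Notation h := (qform a).
Local Notation V := (q ^ (2 * m))%N.
Local Notation r := (q ^ (2 * (m - j)))%N.
Definition level c := [set x | h x == c].

Lemma card_rad : #|rad a| = r. Proof. by rewrite card_vspace dim_a. Qed.

Lemma qform0 : h 0 = 0. Proof. by rewrite (qform_rad dimL dimK memK) ?mem0v. Qed.

Lemma qformD_rad x z : z \in rad a -> h (x + z) = h x.
Proof.
move=> az; rewrite qformD // (qform_rad dimL dimK memK az) addr0.
by move: az; rewrite mem_rad => /eqP ->; rewrite mulr0 tr0 addr0.
Qed.

Lemma card_level_neq0 c c' : c != 0 -> c' != 0 -> #|level c| = #|level c'|.
Proof.
suff le d d' : d != 0 -> d' != 0 -> (#|level d| <= #|level d'|)%N.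
  by move=> c0 c'0; apply/eqP; rewrite eqn_leq !le.
move=> d0 d'0; have [l Kl El] := norm_K_surj (mulf_neq0 d'0 (invr_neq0 d0)).
have lN0 : l != 0.
  apply: contraNneq (mulf_neq0 d'0 (invr_neq0 d0)) => l0.
  by apply/eqP/(@scal_inj _ L0); rewrite /= El l0 mulr0 scale0r.
rewrite -(card_imset _ (mulfI lN0)); apply/subset_leq_card/subsetP.
move=> _ /imsetP[x /[!inE] /eqP hx ->].
by rewrite (qformM dimL dimK memK _ _ Kl El) hx divfK.
Qed.

Lemma sum_card_level : (\sum_c #|level c| = V)%N.
Proof.
rewrite -(card_ext dimL) -[RHS]sum1_card (partition_big h predT) //=.
by apply: eq_bigr => c _; rewrite sum1dep_card.
Qed.

(** Counts pairs (y, z) with h(y + z) = h(y), that is, h(z) + tr(y adj z) = 0. Every y qualifies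
    when z is in the radical; otherwise the condition is a nonconstant affine equation in y,
    satisfied by V / q elements. *)
Lemma second_moment : (q * \sum_c #|level c| ^ 2 = q * r * V + (V - r) * V)%N.
Proof.
have -> : (\sum_c #|level c| ^ 2 = \sum_(z : L) #|[set y : L | h (y + z)%R == h y]|)%N.
  transitivity (\sum_(y : L) #|level (h y)|)%N.
    rewrite (partition_big h predT) //=; apply: eq_bigr => c _.
    rewrite (eq_bigr (fun=> #|level c|)) => [|y /eqP -> //].
    by rewrite sum_nat_const -mulnn; congr (_ * _)%N; apply: eq_card => x; rewrite !inE.
  under [RHS]eq_bigr do rewrite -sum1dep_card big_mkcond /=.
  rewrite [RHS]exchange_big /=; apply: eq_bigr => y _.
  rewrite -big_mkcond sum1dep_card -[RHS](card_imset _ (addrI y)).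
  apply: eq_card => x; rewrite !inE; apply/idP/imsetP => [hx|[z /[!inE] hz -> //]].
  by exists (x - y); rewrite ?inE addrC subrK.
rewrite big_distrr (bigID [in rad a]) /=.
rewrite (eq_bigr (fun=> (q * V)%N)) => [|z az]; last first.
  congr (_ * _)%N; rewrite -(card_ext dimL) -(cardsT L); apply: eq_card => y.
  by rewrite !inE qformD_rad // eqxx.
rewrite sum_nat_const card_rad.
rewrite (eq_bigr (fun=> V)) => [|z az]; last first.
  have zN0 : adj a z != 0 by rewrite -mem_rad.
  have [y0 try0] := tr_eq1 zN0.
  rewrite -(card_ext dimL) -(cardsT L).
  rewrite -(@card_shift_fiber _ _ setT (fun y => h z + tr (y * adj a z))
               (fun s => s *: y0) _ _ 0); first last.
  - by move=> x s _; rewrite mulrDl trD -scalerAl trZ try0 mulr1 addrA.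
  - by move=> x s _; rewrite inE.
  congr (_ * _)%N; apply: eq_card => y; rewrite !inE qformD // -addrA.
  by rewrite -subr_eq0 addrAC subrr add0r.
rewrite sum_nat_const mulnCA mulnA; congr (_ + _ * _)%N.
rewrite -card_rad -(card_ext dimL) -(cardC (mem (rad a))) addKn.
by apply: eq_card => z; rewrite !inE.
Qed.

(** By [card_level_neq0] the first two moments involve only N and M. Eliminating M gives (q N - V)^2
    = (q - 1)^2 r V, where V = r q^(2j). *)
Lemma card_level_int (c : F) : c != 0 ->
  let N := #|level 0| : int in let M := #|level c| : int in
  [/\ N + (q%:Z - 1) * M = V%:Z
    & (q%:Z * N - V%:Z) ^+ 2 = ((q%:Z - 1) * (- q%:Z) ^+ j * r%:Z) ^+ 2].
Proof.
move=> cN0 N M.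
have lev d : d != 0 -> #|level d| = #|level c| by move/card_level_neq0; apply.
have q1 := q_gt0 F.
have cF : #|[pred d : F | d != 0]| = q.-1.
  by rewrite [in RHS](cardD1 0) /=; apply: eq_card => d; rewrite !inE andbT.
have /(congr1 Posz) E1 := sum_card_level.
rewrite (bigD1 0) //= (eq_bigr _ lev) sum_nat_const cF in E1.
have {}E1 : N + (q%:Z - 1) * M = V%:Z by rewrite -E1 PoszD PoszM predn_int.
split=> //; have /(congr1 Posz) E2 := second_moment.
have lev2 d : d != 0 -> (#|level d| ^ 2 = #|level c| ^ 2)%N by move/lev ->.
rewrite (bigD1 0) //= (eq_bigr _ lev2) sum_nat_const cF in E2.
have le_rV : (r <= V)%N by rewrite leq_exp2l ?q_gt1 //; lia.
have {}E2 : q%:Z * (N ^+ 2 + (q%:Z - 1) * M ^+ 2) = q%:Z * r%:Z * V%:Z + (V%:Z - r%:Z) * V%:Z.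
  by rewrite !expr2; move: E2; rewrite -!mulnn !(PoszD, PoszM) predn_int // -subzn.
have EV : V%:Z = r%:Z * (q%:Z ^+ j) ^+ 2.
  by rewrite -exprM -[_ ^+ (j * 2)](rmorphXn Posz) -PoszM -expnD; congr (Posz (_ ^ _)); lia.
have Eb2 : ((- q%:Z) ^+ j) ^+ 2 = (q%:Z ^+ j) ^+ 2.
  by rewrite -!exprM mulnC !exprM sqrrN.
transitivity ((q%:Z - 1) ^+ 2 * r%:Z * V%:Z);
  last by rewrite EV -Eb2; move: ((- q%:Z) ^+ j) => B; ring.
have /(congr1 ( *%R (q%:Z - 1))) := E2.
have -> : (q%:Z - 1) * (q%:Z * (N ^+ 2 + (q%:Z - 1) * M ^+ 2)) =
   q%:Z * ((q%:Z - 1) * N ^+ 2 + ((q%:Z - 1) * M) ^+ 2) by ring.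
have -> : (q%:Z - 1) * M = V%:Z - N by rewrite -E1; ring.
move=> E3; transitivity (q%:Z * ((q%:Z - 1) * N ^+ 2 + (V%:Z - N) ^+ 2) - (q%:Z - 1) * V%:Z ^+ 2).
  by ring.
by rewrite E3; ring.
Qed.

Lemma even_power_mod k : exists s : int, (q%:Z) ^+ (2 * k) = 1 + s * (q%:Z ^+ 2 - 1).
Proof.
exists (\sum_(i < k) (q%:Z ^+ 2) ^+ i).
by rewrite mulrC -subrX1 exprM addrC subrK.
Qed.

Lemma card_level0_int : q%:Z * #|level 0|%:Z - V%:Z = (q%:Z - 1) * (- q%:Z) ^+ j * r%:Z.
Proof.
have [_ /eqP] := card_level_int (oner_neq0 F).
rewrite eqf_sqr => /orP[/eqP //|/eqP E]; exfalso.
have [k Ek] : exists k : int, #|level 0|%:Z = 1 + k * (q%:Z ^+ 2 - 1).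
  have : ((q ^ 2).-1 %| #|level 0%R :\ 0%R|)%N.
    apply: card_K_invariant => [|l x Kl lN0]; first by rewrite !inE eqxx.
    rewrite !inE => /andP[xN0 /eqP hx]; rewrite mulf_neq0 //=.
    have [c Ec _] := norm_trace_K memK Kl.
    by rewrite (qformM dimL dimK memK _ _ Kl Ec) hx mulr0.
  case/dvdnP => k Ek; exists k%:Z; rewrite (cardsD1 0) Ek inE qform0 eqxx.
  rewrite PoszD PoszM; congr (_ + _ * _).
  by have := q_gt0 F; case: (q) => // q' _; lia.
have [v Ev] := even_power_mod m.
have [rho Er] := even_power_mod (m - j).
have [be Eb] := even_power_mod j./2.
have Ebj : (- q%:Z) ^+ j = (- q%:Z) ^+ odd j * q%:Z ^+ (2 * j./2).
  by rewrite -{1}(odd_double_half j) exprD -mul2n [in LHS]exprM sqrrN -exprM.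
rewrite -!(rmorphXn Posz) in Ev Er; rewrite Ek Ev Er Ebj Eb in E.
have q2 := q_gt1 F.
(* Modulo q^2 - 1 one has N = 1 and even powers of q are 1. With the wrong sign, both parities of j
   lead to 2(q - 1) = 0, that is, q + 1 divides 2. The two witnesses collect the discarded
   multiples; the final 1 for odd j comes from reducing q^2. *)
suff [X EX] : exists X : int, 2 * (q%:Z - 1) = X * (q%:Z ^+ 2 - 1).
  have : (2 - X * (q%:Z + 1)) * (q%:Z - 1) = 0 by rewrite mulrBl EX; ring.
  have {}q2 : 2 <= q%:Z by rewrite lez_nat.
  move/eqP; rewrite mulf_eq0 => /orP[/eqP E1|/eqP]; last by lia.
  by have [] := lerP X 0; nia.
move/eqP: E; rewrite -subr_eq0; case: odd; rewrite ?expr1 ?expr0 => /eqP E.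
- exists (v - q%:Z * k + (q%:Z - 1) * q%:Z * (be + rho + be * rho * (q%:Z ^+ 2 - 1)) + 1).
  by apply: subr0_eq; rewrite -[RHS]E; ring.
exists (v - q%:Z * k - (q%:Z - 1) * (be + rho + be * rho * (q%:Z ^+ 2 - 1))).
by apply: subr0_eq; rewrite -[RHS]E; ring.
Qed.

Local Notation b := (- (q%:R : rat)).
Local Notation Q := (q%:R : rat).

Lemma card_level0 : Q * #|level 0|%:R = V%:R + (Q - 1) * b ^+ j * r%:R.
Proof.
have /(congr1 (fun x : int => x%:~R : rat)) := card_level0_int.
rewrite !(rmorphB, rmorphM, rmorphXn, rmorphN) /= -!pmulrn => E.
by rewrite -E; ring.
Qed.

Lemma card_level1 : Q * #|level 1|%:R = V%:R - b ^+ j * r%:R.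
Proof.
have [/(congr1 (fun x : int => x%:~R : rat)) E _] := card_level_int (oner_neq0 F).
move: E; rewrite !(rmorphD, rmorphB, rmorphM) /= -!pmulrn => E.
have E0 := card_level0.
have Q1 : Q - 1 != 0 by rewrite subr_eq0 pnatr_eq1 gtn_eqF ?q_gt1.
apply: (mulfI Q1); rewrite mulrCA.
have -> : (Q - 1) * #|level 1|%:R = V%:R - #|level 0|%:R by rewrite -[V%:R]E; ring.
by rewrite mulrBr E0; ring.
Qed.

Definition zeros z := #|[set x | h x + tr (x * z) == 0]|.

Lemma zeros_adj y : zeros (adj a y) = #|level (h y)|.
Proof.
rewrite /zeros -(card_imset _ (addIr y)); apply: eq_card => x; rewrite !inE.
apply/imsetP/idP => [[z /[!inE] /eqP hz ->]|/eqP hx].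
  by rewrite qformD // addrAC hz add0r.
exists (x - y); last by rewrite subrK.
rewrite inE; apply/eqP/(addIr (h y)).
by rewrite add0r addrAC -qformD // subrK.
Qed.

(** As [adj a] is self-adjoint for the trace form, its image annihilates its kernel; equality
    follows by comparing cardinalities. *)
Lemma adj_image : adj a @: [set: L] = annih (rad a).
Proof.
apply/eqP; rewrite eqEcard; apply/andP; split.
  apply/subsetP => _ /imsetP[y _ ->]; rewrite inE; apply/forall_inP => x ax.
  by rewrite tr_adj_annih.
have rgt0 : (0 < r)%N by rewrite expn_gt0 q_gt0.
rewrite -(leq_pmul2r rgt0) -{1}dim_a card_annih dimL -(card_ext dimL) -(cardsT L).
rewrite (card_additive_fiber (adj a)); last by move=> ? ? _ _; rewrite inE.
rewrite leq_mul2l -card_rad; apply/orP; right; apply/subset_leq_card/subsetP => x.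
by rewrite !inE mem_rad.
Qed.

(** Some x0 in the radical has tr(x0 z) nonzero. Translation along F x0 leaves h unchanged and
    shifts the linear term through all of F. *)
Lemma zeros_notin z : z \notin adj a @: [set: L] -> (q * zeros z = V)%N.
Proof.
rewrite adj_image inE negb_forall_in => /exists_inP[x0 ax0 trN0].
rewrite -(card_ext dimL) -(cardsT L).
rewrite -(@card_shift_fiber _ _ setT (fun x => h x + tr (x * z))
  (fun s => (s / tr (x0 * z)) *: x0) _ _ 0) => [|x s _|x s _].
- by congr (_ * _)%N; apply: eq_card => x; rewrite !inE.
- by rewrite inE.
by rewrite qformD_rad ?memvZ // mulrDl trD -scalerAl trZ divfK // addrA.
Qed.

(** Later phi is the indicator of a weight. The first term comes from z outside the image of
    [adj a]; the other two from z = adj a y with h(y) zero or nonzero. *)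
Lemma sum_zeros (phi : nat -> rat) :
  \sum_z phi (zeros z) =
    (Q ^+ (2 * m) - Q ^+ (2 * j)) * phi (q ^ (2 * m - 1))%N
  + (Q ^+ (2 * j) + (Q - 1) * b ^+ j) / Q * phi #|level 0|
  + (Q - 1) * (Q ^+ (2 * j) - b ^+ j) / Q * phi #|level 1|.
Proof.
have Q0 : Q != 0 by rewrite pnatr_eq0 -lt0n q_gt0.
have r0 : (r%:R : rat) != 0 by rewrite pnatr_eq0 -lt0n expn_gt0 q_gt0.
have m0 := half_degree_gt0 dimL.
have EV : V%:R = Q ^+ (2 * j) * r%:R.
  by rewrite -natrX -natrM -expnD; congr (_ ^ _)%:R; lia.
rewrite (bigID [in adj a @: [set: L]]) /= [X in _ + X](eq_bigr (fun=> phi (q ^ (2 * m - 1))%N)).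
  rewrite sumr_const addrC -addrA; congr (_ + _).
    rewrite -[LHS]mulr_natl; congr (_ * _).
    have := card_annih (rad a); rewrite dim_a dimL -adj_image => E.
    have cI : (#|adj a @: [set: L]| = q ^ (2 * j))%N.
      apply/eqP; rewrite -(@eqn_pmul2r r) ?expn_gt0 ?q_gt0 // E -expnD.
      by apply/eqP; congr (_ ^ _)%N; lia.
    rewrite -!natrX -natrB ?leq_exp2l ?q_gt1 ?leq_mul2l //; congr (_%:R).
    rewrite -cI -(card_ext dimL) -(cardC (mem (adj a @: [set: L]))) addKn.
    by apply: eq_card => z; rewrite !inE.
  (* Each z in the image has r preimages y, so multiplying by r turns the sum over the image into a
     sum over all y. *)
  apply: (mulfI r0).
  have := sum_additive_fiber (adj a) (fun z => phi (zeros z)).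
  have -> : #|[set x | adj a x == 0]| = r.
    by rewrite -card_rad; apply: eq_card => x; rewrite !inE mem_rad.
  move=> <-; rewrite (eq_bigr (fun y => phi #|level (h y)|)) => [|y _]; last first.
    by rewrite zeros_adj.
  rewrite (partition_big h predT) //= (bigD1 0) //=.
  rewrite (eq_bigr (fun=> phi #|level 0|)) => [|y /eqP -> //].
  rewrite sumr_const.
  rewrite (eq_bigr (fun c => phi #|level 1| *+ #|level 1|)) => [|c cN0]; last first.
    rewrite (eq_bigr (fun=> phi #|level c|)) => [|y /eqP -> //].
    rewrite sumr_const (card_level_neq0 cN0 (oner_neq0 F)); congr (_ *+ _).
    rewrite -(card_level_neq0 cN0 (oner_neq0 F)).
    by apply: eq_card => y; rewrite !inE.
  rewrite sumr_const.
  have -> : #|[pred c : F | c != 0]| = q.-1.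
    by rewrite [in RHS](cardD1 0) /=; apply: eq_card => d; rewrite !inE andbT.
  rewrite -![phi _ *+ _]mulr_natl -[(_ * phi _) *+ _]mulr_natl.
  have -> : (q.-1)%:R = Q - 1 by rewrite -subn1 natrB ?q_gt0.
  have -> : #|[pred y | h y == 0]| = #|level 0| by apply: eq_card => y; rewrite !inE.
  apply: (mulfI Q0); rewrite mulrDr !mulrA [Q * (Q - 1)]mulrC -[_ * Q * _]mulrA.
  rewrite card_level0 card_level1 EV; field; exact: Q0.
move=> z /zeros_notin Ez; congr phi; apply/eqP.
rewrite -(@eqn_pmul2l q) ?q_gt0 // Ez -expnS; apply/eqP; congr (_ ^ _)%N; lia.
Qed.

End OneForm.
End Zeros.

(** * Cyclic ideals and trace codewords *)

Section CyclicIdeals.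

Variables (F : finFieldType) (n : nat).
Hypothesis n_gt0 : (0 < n)%N.
Implicit Types (g h : {poly F}) (c : 'rV[F]_n).
Local Notation Xn1 := ('X^n - 1 : {poly F}).

Lemma size_Xn1 : size Xn1 = n.+1.
Proof. exact: size_XnsubC. Qed.

Lemma Xn1_neq0 : Xn1 != 0.
Proof. by rewrite -size_poly_eq0 size_Xn1. Qed.

Lemma mem_cyclic_ideal g c : g %| Xn1 -> (c \in cyclic_ideal n g) = (g %| rVpoly c).
Proof.
move=> gX; rewrite inE; apply/existsP/idP => [[a /eqP ->]|gc].
  by rewrite -dvdp_mod // dvdp_mull.
exists (poly_rV (rVpoly c %/ g)).
have szc : (size (rVpoly c) <= n)%N by exact: size_poly.
rewrite poly_rV_K; last by apply: leq_trans szc; rewrite leq_divp.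
by rewrite divpK // modp_small // size_Xn1 ltnS.
Qed.

Lemma card_cyclic_ideal_le g h : g * h = Xn1 ->
  (#|cyclic_ideal n g| <= #|F| ^ (size h).-1)%N.
Proof.
move=> gh; have gX : g %| Xn1 by rewrite -gh dvdp_mulr.
have := Xn1_neq0; rewrite -gh mulf_eq0 negb_or => /andP[g0 h0].
have szgh : (size g + size h = n.+2)%N.
  have := size_mul g0 h0; rewrite gh size_Xn1.
  by move: g0 h0; rewrite -!size_poly_gt0; case: (size g) => // k _ _; rewrite addSn => ->.
pose f c : 'rV[F]_((size h).-1) := poly_rV (rVpoly c %/ g).
have f_inj : {in cyclic_ideal n g &, injective f}.
  move=> c c'; rewrite !mem_cyclic_ideal // => gc gc' ff.
  have szf (d : 'rV[F]_n) : (size (rVpoly d %/ g)%R <= (size h).-1)%N.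
    rewrite size_divp // leq_subLR.
    have : (size (rVpoly d) <= n)%N by exact: size_poly.
    move: g0 h0 szgh; rewrite -!size_poly_gt0.
    by move: (size (rVpoly d)) (size g) (size h) => x y z; lia.
  apply: (can_inj rVpolyK); rewrite -(divpK gc) -(divpK gc').
  by rewrite -(poly_rV_K (szf c)) -(poly_rV_K (szf c')) -/(f c) ff.
rewrite -(card_in_imset f_inj) -[X in (_ <= _ ^ X)%N]mul1n -card_mx.
exact: max_card.
Qed.

(** The remainder modulo g, as a linear map, exhibits the ideal as a kernel and hence as a vector
    space. *)
Definition syndrome g c : 'rV[F]_n := poly_rV (rVpoly c %% g).

Lemma syndrome_is_linear g : linear (syndrome g).
Proof. by move=> a c d; rewrite /syndrome linearP modpD modpZl linearP. Qed.

HB.instance Definition _ g := GRing.isLinear.Build F 'rV[F]_n 'rV[F]_n *:%R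
  (syndrome g) (syndrome_is_linear g).

Lemma cyclic_ideal_vspace g : g %| Xn1 ->
  cyclic_ideal n g =i lker (linfun (syndrome g)).
Proof.
move=> gX c; rewrite mem_cyclic_ideal // memv_ker lfunE /= /syndrome.
have szg : (size (rVpoly c %% g)%R <= n)%N.
  have g0 : g != 0 by apply: contraTneq gX => ->; rewrite dvd0p Xn1_neq0.
  rewrite -ltnS -size_Xn1; apply: leq_trans (dvdp_leq Xn1_neq0 gX).
  by rewrite ltn_modp.
by rewrite /dvdp -(inj_eq (can_inj rVpolyK)) poly_rV_K // linear0.
Qed.

End CyclicIdeals.

Section Code.

Variables (F : finFieldType) (L0 : fieldExtType F) (m : nat).
Hypotheses (dimL : \dim {:L0} = (2 * m)%N) (m_even : ~~ odd m).
Local Notation L := (finvect_type L0).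
Local Notation q := #|F|.
Local Notation t := m./2.
Local Notation n := (q ^ (2 * m) - 1)%N.
Variable pi : L.
Hypothesis pi_gen : generates_units pi.
Implicit Types (x y z : L) (c : F) (a : 'rV[L]_t).

Lemma code_length_gt0 : (0 < n)%N.
Proof.
by rewrite subn_gt0 -{1}(expn0 q) ltn_exp2l ?q_gt1 // muln_gt0 /= (half_degree_gt0 dimL).
Qed.

Lemma card_units : #|[set x : L | x != 0]| = n.
Proof.
rewrite -(card_ext dimL) [in RHS](cardD1 0) add1n subn1 /=.
by apply: eq_card => x; rewrite !inE andbT.
Qed.

Lemma unit_exp_n x : x != 0 -> x ^+ n = 1.
Proof.
move=> x0; apply: (mulfI x0); rewrite mulr1 -exprS -(card_ext dimL).
rewrite subn1 prednK ?expf_card //.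
by rewrite (card_ext dimL) expn_gt0 q_gt0.
Qed.

Lemma pi_neq0 : pi != 0. Proof. by case: pi_gen. Qed.

(** If k is the order of pi, all n nonzero elements are powers of pi and hence roots of X^k - 1, so
    n <= k. *)
Lemma pi_prim : n.-primitive_root pi.
Proof.
have [k prim_k k_n] := prim_order_exists code_length_gt0 (unit_exp_n pi_neq0).
suff le_nk : (n <= k)%N.
  by rewrite (_ : n = k) //; apply/eqP; rewrite eqn_leq le_nk (dvdn_leq code_length_gt0 k_n).
have k0 := prim_order_gt0 prim_k.
have sz := size_XnsubC (1 : L) k0.
rewrite -card_units cardE -ltnS -sz; apply: max_poly_roots (enum_uniq _).
  by rewrite -size_poly_eq0 sz.
apply/allP => x; rewrite mem_enum inE => /(proj2 pi_gen)[i ->].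
rewrite rootE !hornerE subr_eq0; apply/eqP.
by rewrite exprnP exprzAC -exprnP (prim_expr_order prim_k) exp1rz.
Qed.

Lemma pi_exp_surj x : x != 0 -> exists i : 'I_n, x = pi ^+ i.
Proof. by move=> x0; have [i ->] := prim_rootP pi_prim (unit_exp_n x0); exists i. Qed.

Definition codeword a z : 'rV[F]_n :=
  \row_i (qform a (pi ^+ i) + tr (pi ^+ i * z)).

Lemma codeword_eq a z a' z' : codeword a z = codeword a' z' ->
  forall x, qform a x + tr (x * z) = qform a' x + tr (x * z').
Proof.
move=> E x; have [->|x0] := eqVneq x 0; last first.
  by have [i ->] := pi_exp_surj x0; move/rowP/(_ i): E; rewrite !mxE.
have qf0 a1 : qform a1 0 = 0.
  by rewrite /qform big1 ?tr0 // => i _; rewrite !mulr0.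
by rewrite !qf0 !mul0r.
Qed.

(** Polarising the equality of functions removes the linear terms and leaves equal adjoints, so a =
    a'; the linear parts then agree too. *)
Lemma codeword_inj a z a' z' : codeword a z = codeword a' z' -> a = a' /\ z = z'.
Proof.
move/codeword_eq => E.
have Ea : a = a'.
  apply/eqP; rewrite -subr_eq0; apply/eqP/(adj_inj dimL) => y.
  rewrite adjlB; apply: tr_nondegenerate => x; rewrite mulrBr trB.
  have rearr (A B T u v : F) : A + B + T + (u + v) = (A + u) + (B + v) + T by ring.
  have := E (x + y); rewrite !qformD // mulrDl trD mulrDl trD !rearr (E x) (E y).
  by move/addrI ->; rewrite subrr.
split=> //; apply/eqP; rewrite -subr_eq0; apply/eqP/tr_nondegenerate => x.
by rewrite mulrBr trB; have := E x; rewrite Ea => /addrI ->; rewrite subrr.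
Qed.

(** The word omits the point 0, which is always a zero, so the total is |L| = n + 1. *)
Lemma weight_codeword a z :
  (hamming_weight (codeword a z) + zeros a z = q ^ (2 * m))%N.
Proof.
rewrite /hamming_weight /zeros -[RHS](card_ext dimL) addnC.
rewrite -[RHS](cardsC [set x | qform a x + tr (x * z) == 0]); congr (_ + _)%N.
have inj_pi : injective (fun i : 'I_n => pi ^+ i).
  move=> i i' /eqP; rewrite (eq_prim_root_expr pi_prim) !modn_small //.
  by move/eqP/val_inj.
rewrite -(card_imset _ inj_pi); apply: eq_card => x; rewrite !inE.
apply/imsetP/idP => [[i /[!inE] + ->]|fx]; first by rewrite mxE.
have [x0|x0] := eqVneq x 0; last first.
  have [i Ei] := pi_exp_surj x0; exists i => //.
  by rewrite inE mxE -Ei.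
case/eqP: fx; rewrite x0 mul0r tr0 addr0 /qform big1 ?tr0 // => i _.
by rewrite !mulr0.
Qed.

End Code.

(** * Identification of the code *)

Lemma size_prod_seq_le (R : nzRingType) (I : Type) (s : seq I) (f : I -> {poly R}) d :
  (forall i, (size (f i) <= d.+1)%N) ->
  (size (\prod_(i <- s) f i)%R <= (size s * d).+1)%N.
Proof.
move=> szf; elim: s => [|i s IHs]; first by rewrite big_nil size_polyC oner_neq0.
rewrite big_cons; apply: leq_trans (size_polyMleq _ _) _.
by move: (szf i) IHs => /=; lia.
Qed.

Lemma sum_expr_eq0 (R : idomainType) (w : R) k :
  w ^+ k = 1 -> w != 1 -> \sum_(i < k) w ^+ i = 0.
Proof.
move=> wk w1; have /esym/eqP := subrX1 w k.
by rewrite wk subrr mulf_eq0 subr_eq0 (negPf w1) => /eqP.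
Qed.

Section Code.

Variables (F : finFieldType) (L0 : fieldExtType F) (m : nat).
Hypotheses (dimL : \dim {:L0} = (2 * m)%N) (m_even : ~~ odd m).
Local Notation L := (finvect_type L0).
Local Notation q := #|F|.
Local Notation t := m./2.
Local Notation n := (q ^ (2 * m) - 1)%N.
Variable pi : L.
Hypothesis pi_gen : generates_units pi.
Implicit Types (x y z : L) (c : F) (a : 'rV[L]_t).
Local Notation H := (h_poly q m pi).
Local Notation Xn1 := ('X^n - 1 : {poly F}).
Local Notation lift_poly := (map_poly (in_alg L)).

Lemma frob_horner k (p : {poly F}) x :
  frob k (lift_poly p).[x] = (lift_poly p).[frob k x].
Proof.
rewrite !horner_coef frob_sum; apply: eq_bigr => i _.
by rewrite coef_map /= frobM frob_scal; congr (_ * _); rewrite /frob exprAC.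
Qed.

Lemma base_minPoly_monic x : base_minPoly x \is monic.
Proof. by rewrite -(map_monic (in_alg L)) base_minPolyE monic_minPoly. Qed.

Lemma size_base_minPoly_le x : (size (base_minPoly x) <= (2 * m).+1)%N.
Proof.
rewrite -(size_map_poly (in_alg L)) base_minPolyE size_minPoly ltnS.
have := dim_Fadjoin 1%AS x; rewrite dimv1 muln1 => <-.
by rewrite -dimL; apply: (dimvS (subvf _)).
Qed.

Lemma h_poly_monic : H \is monic.
Proof. by apply: monic_prod => u _; apply: base_minPoly_monic. Qed.

Lemma size_h_poly_le : (size H <= (m ^ 2 + 2 * m).+1)%N.
Proof.
apply: leq_trans (size_prod_seq_le _ (fun u => size_base_minPoly_le (pi ^- u))) _.
rewrite /= size_map size_iota ltnS.
have := odd_double_half m; rewrite (negPf m_even) add0n -muln2.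
by move: m./2 => k <-; lia.
Qed.

Lemma h_poly_root u k : u \in Gamma q m -> root (lift_poly H) (frob k (pi ^- u)).
Proof.
move=> Gu; rewrite rootE -frob_horner rmorph_prod horner_prod.
have /eqP -> : \prod_(v <- Gamma q m) (lift_poly (base_minPoly (pi ^- v))).[pi ^- u] == 0.
  rewrite prodf_seq_eq0; apply/hasP; exists u => //=.
  by rewrite base_minPolyE; exact: root_minPoly.
by rewrite frob0.
Qed.

(** Expanding the trace splits the value at x into geometric sums with ratio w =
    [frob k (pi ^+ u) * x], u in [Gamma]. Here w^n = 1, and w = 1 would make x a conjugate of
    pi^(-u), hence a root of H. *)
Lemma codeword_horner a z x : x != 0 -> ~~ root (lift_poly H) x ->
  (lift_poly (rVpoly (codeword pi a z))).[x] = 0.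
Proof.
move=> x0 Hx.
have pi0 : pi != 0 := pi_neq0 pi_gen.
have sum0 k u y : u \in Gamma q m ->
    \sum_(i < n) frob k (y * (pi ^+ i) ^+ u) * x ^+ i = 0.
  move=> Gu; pose w := frob k (pi ^+ u) * x.
  have w1 : w != 1.
    apply: contraNneq Hx => w1; have := h_poly_root k Gu.
    suff -> : frob k (pi ^- u) = x by [].
    have fN0 : frob k (pi ^+ u) != 0 by rewrite /frob !expf_neq0.
    apply: (mulfI fN0); rewrite -/w w1 -frobM divff ?expf_neq0 //.
    by rewrite /frob expr1n.
  have wn : w ^+ n = 1.
    by rewrite (unit_exp_n dimL) // mulf_neq0 // /frob !expf_neq0.
  rewrite (eq_bigr (fun i : 'I_n => frob k y * w ^+ i)) => [|i _].
    by rewrite -mulr_sumr sum_expr_eq0 ?mulr0.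
  rewrite frobM -mulrA /w exprMn; congr (_ * (_ * _)).
  by rewrite /frob -!exprM mulnC.
have szc : (size (lift_poly (rVpoly (codeword pi a z))) <= n)%N.
  by rewrite size_map_poly size_poly.
rewrite (horner_coef_wide _ szc).
(* [Gamma] counts from 1 with exponents 2i - 1 and [qform] from 0 with 2l + 1, whence [l.+1]; the
   term with z corresponds to u = 1. *)
rewrite (eq_bigr (fun i : 'I_n =>
  \sum_(k < \dim {:L0}) (\sum_(l < t) frob k (a 0 l * (pi ^+ i) ^+ (q ^ (2 * l.+1 - 1) + 1)) * x ^+ i
   + frob k (z * (pi ^+ i) ^+ 1) * x ^+ i))); last first.
  move=> i _; rewrite coef_map coef_rVpoly_ord mxE /=.
  rewrite /qform -trD trE /trL mulr_suml; apply: eq_bigr => k _.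
  rewrite frobD frob_sum mulrDl mulr_suml expr1 mulrC [pi ^+ i * z]mulrC.
  rewrite [in LHS]mulrC; congr (_ + _); apply: eq_bigr => l _.
  congr (frob _ (_ * _) * _).
  by rewrite /frob -exprSr [in RHS]addn1 (_ : 2 * l.+1 - 1 = 2 * l + 1)%N //; lia.
rewrite exchange_big big1 // => k _; rewrite /= big_split /= exchange_big /=.
rewrite sum0 ?mem_head // addr0 big1 // => l _; apply: sum0.
rewrite inE; apply/orP; right; apply/mapP; exists l.+1 => //.
by rewrite mem_iota /= add1n ltnS ltn_ord.
Qed.

Lemma lift_Xn1_dvd (p : {poly F}) :
  (forall x, x != 0 -> root (lift_poly p) x) -> Xn1 %| p.
Proof.
move=> rp; rewrite -(dvdp_map (in_alg L)) rmorphB /= map_polyXn rmorph1.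
rewrite -(factor_Xn_sub_1 (pi_prim dimL pi_gen)).
have -> : \prod_(0 <= i < n) ('X - (pi ^+ i)%:P) =
   \prod_(x <- [seq pi ^+ i | i <- index_iota 0 n]) ('X - x%:P) by rewrite big_map.
apply: uniq_roots_dvdp.
  apply/allP => _ /mapP[i _ ->]; apply: rp; rewrite expf_neq0 //.
  exact: pi_neq0 pi_gen.
rewrite uniq_rootsE map_inj_in_uniq ?iota_uniq // => i j.
rewrite !mem_index_iota => /andP[_ lti] /andP[_ ltj] /eqP.
by rewrite (eq_prim_root_expr (pi_prim dimL pi_gen)) !modn_small // => /eqP.
Qed.

(** P is general because this is applied first to gcd(H, X^n - 1), while H is not yet known to
    divide X^n - 1, and then to H. *)
Lemma dvdp_codeword (P : {poly F}) a z : P %| Xn1 ->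
    (forall x, x != 0 -> root (lift_poly H) x -> root (lift_poly P) x) ->
  (Xn1 %/ P) %| rVpoly (codeword pi a z).
Proof.
move=> PX rootP.
have P0 : P != 0 by rewrite (dvdpN0 PX) ?(Xn1_neq0 _ (code_length_gt0 dimL)).
rewrite -(dvdp_mul2r _ _ P0) divpK //; apply: lift_Xn1_dvd => x x0.
rewrite rmorphM rootM; have [Hx|Hx] := boolP (root (lift_poly H) x).
  by rewrite rootP ?orbT.
by rewrite rootE codeword_horner // eqxx.
Qed.

Definition codewords := [set codeword pi p.1 p.2 | p : 'rV[L]_t * L].

Lemma codeword_pair_inj : injective (fun p : 'rV[L]_t * L => codeword pi p.1 p.2).
Proof.
by move=> [a z] [a' z'] /(codeword_inj dimL pi_gen) /= [-> ->].
Qed.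

Lemma card_codewords : #|codewords| = (q ^ (m ^ 2 + 2 * m))%N.
Proof.
rewrite card_imset; last exact: codeword_pair_inj.
rewrite card_prod card_mx mul1n (card_ext dimL) -expnM -expnD; congr (_ ^ _)%N.
have := odd_double_half m; rewrite (negPf m_even) add0n -muln2.
by move: m./2 => k <-; lia.
Qed.

(** Counting codewords replaces a direct check that the minimal polynomials in H are pairwise
    distinct. *)
Lemma h_poly_dvd : H %| Xn1.
Proof.
have n0 := code_length_gt0 dimL.
set h := gcdp H Xn1.
have hX : h %| Xn1 := dvdp_gcdr _ _.
have hH : h %| H := dvdp_gcdl _ _.
have gX : Xn1 %/ h %| Xn1 by rewrite -{2}(divpK hX) dvdp_mulr.
have sub : codewords \subset cyclic_ideal n (Xn1 %/ h).
  apply/subsetP => _ /imsetP[[a z] _ ->].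
  rewrite mem_cyclic_ideal //; apply: dvdp_codeword => // x x0 Hx.
  rewrite /= gcdp_map root_gcd Hx rmorphB /= map_polyXn rmorph1 rootE !hornerE.
  by rewrite (unit_exp_n dimL) // subrr eqxx.
have le1 := leq_trans (subset_leq_card sub) (card_cyclic_ideal_le n0 (divpK hX)).
rewrite card_codewords leq_exp2l ?q_gt1 // in le1.
have le2 := dvdp_leq (monic_neq0 h_poly_monic) hH.
have h0 : (0 < size h)%N.
  by rewrite size_poly_gt0 (dvdpN0 hX) // (Xn1_neq0 _ n0).
have := dvdp_size_eqp hH; have -> : size h == size H.
  by rewrite eqn_leq le2 (leq_trans size_h_poly_le) // -(prednK h0) ltnS.
by move/esym/eqp_dvdl => <-.
Qed.

Lemma code_DE : code_D q m pi = codewords.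
Proof.
have n0 := code_length_gt0 dimL.
apply/esym/eqP; rewrite eqEcard; apply/andP; split.
  apply/subsetP => _ /imsetP[[a z] _ ->].
  have gX : Xn1 %/ H %| Xn1 by rewrite -{2}(divpK h_poly_dvd) dvdp_mulr.
  by rewrite mem_cyclic_ideal // dvdp_codeword // h_poly_dvd.
rewrite card_codewords; apply: leq_trans (card_cyclic_ideal_le n0 (divpK h_poly_dvd)) _.
by rewrite leq_exp2l ?q_gt1 // -subn1 leq_subLR add1n size_h_poly_le.
Qed.

End Code.

(** * Weight distribution *)

Lemma hamming_distE (F : finFieldType) n (x y : 'rV[F]_n) :
  hamming_dist x y = hamming_weight (x - y).
Proof. by apply: eq_card => i; rewrite !inE !mxE subr_eq0. Qed.

Section WeightDistribution.

Variables (F : finFieldType) (L0 : fieldExtType F) (m : nat).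
Hypotheses (dimL : \dim {:L0} = (2 * m)%N) (m_even : ~~ odd m).
Local Notation L := (finvect_type L0).
Local Notation q := #|F|.
Local Notation t := m./2.
Local Notation n := (q ^ (2 * m) - 1)%N.
Variable pi : L.
Hypothesis pi_gen : generates_units pi.
Variable K : {subfield L}.
Hypotheses (dimK : \dim K = 2%N) (memK : forall x, (x \in K) = (frob 2 x == x)).
Implicit Types (x y z : L) (c : F) (a : 'rV[L]_t).
Local Notation H := (h_poly q m pi).
Local Notation C := (code_D q m pi).
Local Notation Xn1 := ('X^n - 1 : {poly F}).
Local Notation Q := (q%:R : rat).
Local Notation b := (- Q).

Lemma code_D_parity_check : cyclic_code_with_parity_check C H.
Proof.
have HX := h_poly_dvd dimL m_even pi_gen.
have Hmon := h_poly_monic m pi.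
exists (Xn1 %/ H); split=> //.
- by rewrite -(monicMr _ Hmon) divpK // monicXnsubC ?(code_length_gt0 dimL).
- by rewrite -{2}(divpK HX) dvdp_mulr.
have g0 : Xn1 %/ H != 0.
  rewrite (dvdpN0 (_ : _ %| Xn1)) ?(Xn1_neq0 _ (code_length_gt0 dimL)) //.
  by rewrite -{2}(divpK HX) dvdp_mulr.
by have := mulKp H g0; rewrite divpK.
Qed.

Lemma code_D_vspace : exists V : {vspace 'rV[F]_n},
  C =i V /\ \dim V = (m ^ 2 + 2 * m)%N.
Proof.
have HX := h_poly_dvd dimL m_even pi_gen.
have gX : Xn1 %/ H %| Xn1 by rewrite -{2}(divpK HX) dvdp_mulr.
exists (lker (linfun (syndrome (Xn1 %/ H)))).
have CV := cyclic_ideal_vspace (code_length_gt0 dimL) gX; split=> //.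
apply/eqP; rewrite -(@eqn_exp2l q) ?q_gt1 //.
rewrite -(card_codewords dimL m_even pi_gen) -(code_DE dimL m_even pi_gen).
by rewrite -card_vspace; apply/eqP/esym/eq_card.
Qed.

Lemma rad_rank a : exists2 j, (j <= m)%N & \dim (rad a) = (2 * (m - j))%N.
Proof.
have [d dim_a le_dm] := module_dim dimL m_even dimK (rad_module dimL dimK memK a).
by exists (m - d)%N; rewrite ?leq_subr // subKn.
Qed.

Lemma qm_expE j : (j <= m)%N ->
  b ^+ j * (q ^ (2 * (m - j)))%:R = (-1) ^+ j * Q * Q ^+ (2 * m - j - 1).
Proof.
move=> le_jm; have m0 := half_degree_gt0 dimL.
rewrite natrX [b ^+ j]exprNn -!mulrA -exprD -exprS.
by congr (_ * _ ^+ _); lia.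
Qed.

Definition weight0 : rat := Q ^+ (2 * m) - Q ^+ (2 * m - 1).
Definition weight1 j : rat := weight0 - (-1) ^+ j * Q ^+ (2 * m - j - 1) * (Q - 1).
Definition weight2 j : rat := weight0 + (-1) ^+ j * Q ^+ (2 * m - j - 1).

Lemma weight_level a j : (j <= m)%N -> \dim (rad a) = (2 * (m - j))%N ->
  Q ^+ (2 * m) - #|level a 0|%:R = weight1 j
  /\ Q ^+ (2 * m) - #|level a 1|%:R = weight2 j.
Proof.
move=> le_jm dim_a; have m0 := half_degree_gt0 dimL.
have Q0 : Q != 0 by rewrite pnatr_eq0 -lt0n q_gt0.
have E0 := card_level0 dimL dimK memK le_jm dim_a.
have E1 := card_level1 dimL dimK memK le_jm dim_a.
rewrite -mulrA qm_expE // in E0; rewrite qm_expE // in E1.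
have EV : (q ^ (2 * m))%:R = Q * Q ^+ (2 * m - 1).
  by rewrite natrX -exprS; congr (_ ^+ _); lia.
rewrite EV in E0 E1.
by split; apply: (mulfI Q0); rewrite mulrBr ?E0 ?E1 /weight1 /weight2 /weight0; ring.
Qed.

Lemma weight_codeword_rat a z :
  (hamming_weight (codeword pi a z))%:R = Q ^+ (2 * m) - (zeros a z)%:R.
Proof.
have /(congr1 (fun k => k%:R : rat)) := weight_codeword dimL pi_gen a z.
by rewrite natrD natrX => <-; rewrite addrK.
Qed.

(** The second case records that z is in the image, because [weight1 0] is 0 and [weight_lower] must
    then recognise the zero word. *)
Lemma zeros_cases a z j : (j <= m)%N -> \dim (rad a) = (2 * (m - j))%N ->
  [\/ (hamming_weight (codeword pi a z))%:R = weight0,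
      (hamming_weight (codeword pi a z))%:R = weight1 j /\ z \in adj a @: [set: L] |
      (hamming_weight (codeword pi a z))%:R = weight2 j].
Proof.
move=> le_jm dim_a; have [W1 W2] := weight_level le_jm dim_a.
rewrite weight_codeword_rat; have [az|az] := boolP (z \in adj a @: [set: L]).
  have /imsetP[y _ Ez] := az; rewrite Ez (zeros_adj dimL).
  have [->|h0] := eqVneq (qform a y) 0; last first.
    constructor 3; rewrite -W2.
    by rewrite (card_level_neq0 dimL dimK memK a h0 (oner_neq0 F)).
  by constructor 2; rewrite W1; split=> //; apply: imset_f; rewrite inE.
constructor 1; rewrite /weight0; congr (_ - _).
have := zeros_notin dimL dimK memK dim_a az => E.
have Q0 : Q != 0 by rewrite pnatr_eq0 -lt0n q_gt0.
apply: (mulfI Q0); rewrite -natrM E -exprS natrX; congr (_ ^+ _).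
by have := half_degree_gt0 dimL; lia.
Qed.


Lemma min_weight : (q ^ (2 * m - 2) * (q ^ 2 - q - 1))%:R =
  weight0 - Q ^+ (2 * m - 2).
Proof.
have m0 := half_degree_gt0 dimL; have q1 := q_gt1 F.
have Eq : (q ^ 2 - q - 1 = q ^ 2 - (q + 1))%N by lia.
rewrite natrM natrX Eq natrB; last by nia.
rewrite natrD natrX /weight0.
have -> : (2 * m = 2 + (2 * m - 2))%N by lia.
have -> : (2 + (2 * m - 2) - 1 = 1 + (2 * m - 2))%N by lia.
have -> : (2 + (2 * m - 2) - 2 = 2 * m - 2)%N by lia.
by rewrite !exprD; ring.
Qed.

Lemma rank0 a : \dim (rad a) = (2 * (m - 0))%N -> a = 0.
Proof.
move=> dim_a; apply: (adj_inj dimL) => y; apply/eqP; rewrite -mem_rad.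
have /eqP -> : rad a == {:L}%VS.
  by rewrite eqEdim subvf dim_a subn0 -[\dim fullv]/(\dim {:L0}) dimL leqnn.
exact: memvf.
Qed.

Lemma Q_ge1 : 1 <= Q.
Proof. by rewrite ler1n q_gt0. Qed.

Lemma weight1_ge j : (0 < j <= m)%N -> weight0 - Q ^+ (2 * m - 2) <= weight1 j.
Proof.
move=> /andP[j0 le_jm]; rewrite /weight1 lerD2l lerN2.
have Qp k : 0 <= Q ^+ k by rewrite exprn_ge0 ?ler0n.
rewrite -signr_odd; case: (boolP (odd j)) => [_|j_even].
  rewrite expr1 mulN1r mulNr; apply: le_trans (Qp _).
  by rewrite oppr_le0 mulr_ge0 // subr_ge0 Q_ge1.
(* Only even j lower the weight here, and then j >= 2, so Q - 1 <= Q suffices. *)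
rewrite expr0 mul1r; apply: (@le_trans _ _ (Q ^+ (2 * m - j - 1) * Q)).
  by apply: ler_wpM2l => //; rewrite lerBlDr lerDl.
have j2 : (2 <= j)%N by case: j j0 j_even {le_jm} => [|[]].
by rewrite -exprSr ler_weXn2l ?Q_ge1 //; lia.
Qed.

Lemma weight2_ge j : (j <= m)%N -> weight0 - Q ^+ (2 * m - 2) <= weight2 j.
Proof.
move=> le_jm; rewrite /weight2 lerD2l.
have Qp k : 0 <= Q ^+ k by rewrite exprn_ge0 ?ler0n.
rewrite -signr_odd; case: (boolP (odd j)) => [j_odd|_].
  rewrite expr1 mulN1r lerN2 ler_weXn2l ?Q_ge1 //.
  by case: j j_odd {le_jm} => // j _; lia.
by rewrite expr0 mul1r (le_trans _ (Qp _)) // oppr_le0.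
Qed.

Lemma weight_lower a z : (a != 0) || (z != 0) ->
  (q ^ (2 * m - 2) * (q ^ 2 - q - 1) <= hamming_weight (codeword pi a z))%N.
Proof.
move=> az; rewrite -(ler_nat rat) min_weight.
have [j le_jm dim_a] := rad_rank a.
have [->|[-> zim]|->] := zeros_cases z le_jm dim_a; last exact: weight2_ge.
  by rewrite gerBl exprn_ge0 ?ler0n.
have [j0|j0] := posnP j; last by rewrite weight1_ge // j0.
rewrite j0 in dim_a; have a0 := rank0 dim_a.
case/imsetP: zim => y _ Ez; move: az.
by rewrite Ez a0 adj_l0 !eqxx.
Qed.

(** The bound is [weight2 1]: a form of rank 1 exists because f_1 is nonzero, it takes the value 1
    at some y, and z = adj a y works. *)
Lemma exists_min_weight : exists a z,
  hamming_weight (codeword pi a z) = (q ^ (2 * m - 2) * (q ^ 2 - q - 1))%N.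
Proof.
have m0 := half_degree_gt0 dimL.
have b0 := b_neq0 F; have b1 := b_exp_neq1 F.
have : #|forms_rank m (0 : {vspace L}) 1| != 0%N.
  have := card_forms_rank dimL m_even dimK memK (U := 0%VS) (j := 1) (n := m).
  rewrite prodv0 sub0v dimv0 subnn => /(_ isT (leqnn _) erefl m0) E.
  rewrite -(pnatr_eq0 rat) E /rank_poly mulf_neq0 ?invr_neq0 ?rank_den_neq0 //.
  rewrite /rank_num big_ord1 muln0 expr0 subr_eq0.
  by rewrite -[(2 * m)%N]prednK ?muln_gt0 ?b1.
rewrite -lt0n card_gt0 => /set0Pn[a]; rewrite !inE sub0v => /eqP dim_a.
have [_ W2] := weight_level m0 dim_a.
have : #|level a 1| != 0%N.
  have := card_level1 dimL dimK memK m0 dim_a; rewrite -(pnatr_eq0 rat) => E.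
  apply/negP => /eqP lev0; move/eqP: E; rewrite lev0 mulr0 eq_sym gt_eqF //.
  rewrite expr1 mulNr opprK addr_gt0 ?mulr_gt0 ?ltr0n ?expn_gt0 ?q_gt0 //.
rewrite -lt0n card_gt0 => /set0Pn[y]; rewrite inE => /eqP hy.
exists a, (adj a y); apply/eqP; rewrite -(eqr_nat rat) weight_codeword_rat.
rewrite (zeros_adj dimL) hy W2 min_weight /weight2 expr1 mulN1r.
by apply/eqP; congr (_ - _ ^+ _); lia.
Qed.

Lemma code_D_min_distance :
  min_distance_is C (q ^ (2 * m - 2) * (q ^ 2 - q - 1)).
Proof.
have [V [CV _]] := code_D_vspace.
have CE := code_DE dimL m_even pi_gen.
have memC a z : codeword pi a z \in C by rewrite CE; apply/imsetP; exists (a, z).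
have cw0 : codeword pi (0 : 'rV[L]_t) 0 = 0.
  apply/rowP => i; rewrite !mxE mulr0 tr0 addr0 /qform big1 ?tr0 // => l _.
  by rewrite mxE mul0r.
have D0 : (0 < q ^ (2 * m - 2) * (q ^ 2 - q - 1))%N.
  rewrite muln_gt0 expn_gt0 q_gt0 /= -subnDA subn_gt0 -mulnn.
  apply: leq_trans (leq_mul (q_gt1 F) (leqnn _)).
  by rewrite mul2n -addnn ltn_add2l q_gt1.
split.
  have [a [z Ew]] := exists_min_weight.
  exists (codeword pi a z), 0; split; rewrite ?hamming_distE ?subr0 //.
  - by rewrite -cw0.
  apply: contraTneq D0 => E; rewrite -Ew E /hamming_weight.
  by rewrite -leqNgt leqn0 cards_eq0; apply/eqP/setP => i; rewrite !inE mxE eqxx.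
move=> x y Cx Cy; rewrite -subr_eq0 hamming_distE.
have : x - y \in C by rewrite CV memvB -?CV.
rewrite CE => /imsetP[[a z] _ -> /=] xy; apply: weight_lower.
by rewrite -negb_and; apply: contra xy => /andP[/eqP -> /eqP ->]; rewrite cw0.
Qed.

(** The rank as an ordinal, for partitioning sums over forms; the argument of [inord] is always at
    most m. *)
Definition rank_index a : 'I_m.+1 := inord (m - (\dim (rad a))./2).

Lemma rank_indexE a j : (rank_index a == j) = (a \in forms_rank m (0 : {vspace L}) j).
Proof.
have [k le_km dim_a] := rad_rank a.
have Ek : rank_index a = k :> nat.
  by rewrite /rank_index inordK dim_a mul2n doubleK ?subKn // ltnS.
rewrite -val_eqE /= Ek !inE sub0v dim_a /= eqn_pmul2l //.
by apply/eqP/eqP => [->//|]; have := ltn_ord j; lia.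
Qed.

Lemma weight_count_sum w : (weight_count C w)%:R =
  \sum_(a : 'rV[L]_t) \sum_z (Q ^+ (2 * m) - (zeros a z)%:R == w%:R)%:R :> rat.
Proof.
rewrite pair_bigA /=.
have -> : weight_count C w =
   #|[set p : 'rV[L]_t * L | Q ^+ (2 * m) - (zeros p.1 p.2)%:R == w%:R]|.
  rewrite /weight_count (code_DE dimL m_even pi_gen).
  rewrite -[RHS](card_imset _ (codeword_pair_inj dimL pi_gen)).
  apply: eq_card => c; rewrite !inE.
  apply/andP/imsetP => [[/imsetP[p _ ->] /eqP Ew]|[p /[!inE] Ew ->]].
    by exists p => //; rewrite inE -weight_codeword_rat Ew.
  split; first by apply/imsetP; exists p.
  by rewrite -(eqr_nat rat) weight_codeword_rat.
rewrite -sum1dep_card natr_sum big_mkcond; apply: eq_bigr => p _ /=.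
by case: ifP.
Qed.

Lemma weight_count_table w : (weight_count C w)%:R = table_count q m w.
Proof.
rewrite weight_count_sum.
pose ind (x : rat) : rat := (x == w%:R)%:R.
pose G j := (Q ^+ (2 * m) - Q ^+ (2 * j)) * ind weight0
  + (Q ^+ (2 * j) + (Q - 1) * b ^+ j) / Q * ind (weight1 j)
  + (Q - 1) * (Q ^+ (2 * j) - b ^+ j) / Q * ind (weight2 j).
transitivity (\sum_(j < m.+1) f_freq q m j * G j).
  rewrite (partition_big rank_index predT) //=; apply: eq_bigr => j _.
  have le_jm : (j <= m)%N by rewrite -ltnS.
  rewrite (eq_bigr (fun=> G j)) => [|a].
    rewrite sumr_const f_freqE -[G j *+ _]mulr_natl; congr (_ * _).
    have := card_forms_rank dimL m_even dimK memK (U := 0%VS) (j := j) (n := m).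
    rewrite prodv0 sub0v dimv0 subnn => /(_ isT (leqnn _) erefl le_jm) <-.
    by congr (_%:R); apply: eq_card => a; rewrite -rank_indexE.
  rewrite rank_indexE !inE sub0v => /eqP dim_a.
  have := sum_zeros dimL dimK memK le_jm dim_a (fun Z => ind (Q ^+ (2 * m) - Z%:R)).
  move=> ->; have [-> ->] := weight_level le_jm dim_a.
  by rewrite natrX.
have Q0 : Q != 0 by rewrite pnatr_eq0 -lt0n q_gt0.
have m0 := half_degree_gt0 dimL.
(* Indicators add up entries of equal weight, so no distinctness of the weights has to be shown. *)
have tableE (s : seq (rat * rat)) :
    \sum_(e <- s | e.1 == w%:R) e.2 = \sum_(e <- s) e.2 * ind e.1.
  rewrite big_mkcond; apply: eq_bigr => e _.
  by rewrite /ind; case: eqP; rewrite ?mulr1 ?mulr0.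
rewrite /table_count tableE /weight_table !big_cons big_cat !big_map /=.
have -> : iota 1 m = index_iota 1 m.+1 by rewrite /index_iota subn1.
rewrite -[in LHS](big_mkord predT (fun j => f_freq q m j * G j)) [LHS]big_ltn //.
(* Rank 0 is the zero form: it yields the zero word and the q^(2m) - 1 words of nonzero linear
   functionals. *)
have G0 : f_freq q m 0 * G 0 = ind 0 + (Q ^+ (2 * m) - 1) * ind weight0.
  have -> : f_freq q m 0 = 1 by rewrite /f_freq !big_ord0 mulr1.
  have W10 : weight1 0 = 0.
    rewrite /weight1 /weight0 subn0 expr0 mul1r.
    have -> : Q ^+ (2 * m) = Q * Q ^+ (2 * m - 1).
      by rewrite -exprS; congr (_ ^+ _); lia.
    by ring.
  rewrite /G W10 muln0 !expr0 subrr mulr0 mul0r mul0r addr0 mul1r mulr1 addrC.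
  by rewrite [1 + _]addrC subrK divff // mul1r.
rewrite G0 mul1r -addrA; congr (_ + _).
rewrite -/weight0 [in RHS]mulrDl -[RHS]addrA; congr (_ + _).
rewrite mulr_suml -!big_split /=.
rewrite !big_seq; apply: eq_bigr => j; rewrite mem_index_iota => /andP[j0 le_jm].
rewrite /G -/(weight1 j) -/(weight2 j).
have EQ : Q ^+ (2 * j) = Q * Q ^+ (2 * j - 1) by rewrite -exprS; congr (_ ^+ _); lia.
have Eb : b ^+ j = (-1) ^+ j * Q * Q ^+ (j - 1).
  by rewrite [LHS]exprNn -mulrA -exprS; congr (_ * _ ^+ _); lia.
rewrite EQ Eb; field; exact: Q0.
Qed.

End WeightDistribution.

Theorem mainTheorem1 (q m : nat)
    (hq : exists p e : nat, [/\ prime p, (0 < e)%N & q = (p ^ e)%N])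
    (hm0 : (0 < m)%N) (hm : ~~ odd m)
    (F : finFieldType) (hF : #|F| = q)
    (L : fieldExtType F) (hL : \dim {:L} = (2 * m)%N)
    (pi : L) (hpi : generates_units pi) :
  [/\ cyclic_code_with_parity_check (code_D q m pi) (h_poly q m pi),
      linear_code_params (code_D q m pi) (m ^ 2 + 2 * m)
        (q ^ (2 * m - 2) * (q ^ 2 - q - 1))
    & forall w : nat, (weight_count (code_D q m pi) w)%:R = table_count q m w].
Proof.
(* [finvect_type L] carries the same operations as [L], but this is a conversion
   only once the structure [L] is an explicit constructor application. *)
subst q; case: L hL pi hpi => T cT hL pi hpi.
have [K [dimK memK]] := quadratic_subfield hL.
split; first exact: (code_D_parity_check hL hm hpi).
  split; first exact: (code_D_vspace hL hm hpi).
  exact: (code_D_min_distance hL hm hpi dimK memK).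
exact: (weight_count_table hL hm hpi dimK memK).
Qed.
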